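(* Let $\mathcal{G}$ be a 4-connected planar graph with $D>Z$, and assume the delay between two consecutive activations of any process is bounded by $T$. Then, running the protocol described in the context, all correct nodes deliver $m_0$ within $O(d)$ time units after the source broadcasts $m_0$, where $d$ is the diameter of the network (the constant in $O(\cdot)$ depending only on $Y$, $Z$ and $T$).
   Context: Graph setting: $\mathcal{G}=(G,E)$ is a finite undirected planar graph with a fixed planar embedding, 4-connected (removing fewer than 4 nodes never disconnects it). A circular path is a sequence of nodes $(u_1,\dots,u_n)$ with consecutive nodes adjacent and $u_n,u_1$ adjacent; a polygon is a circular path not surrounding any node in the embedding. $Z\ge3$ is the maximal number of edges per polygon and $Y\ge 4$ the maximal number of edges at a node. Nodes are correct or Byzantine (arbitrary behavior, unknown to correct nodes); $D$ is the minimal distance in hops between two distinct Byzantine nodes. Network model: message passing between neighbors, asynchronous (messages eventually received; every process activated infinitely often), authenticated channels (receiver knows the sending neighbor). A correct source wants to broadcast $m_0$. Multicast = send to all neighbors; deliver $m$ = permanently consider $m$ to be the source's information. Protocol (messages are pairs $(m,S)$, $S$ a set of node identifiers): the source multicasts $m_0$; each correct neighbor of the source waits to receive some $m$ from the source, then delivers $m$ and multicasts $(m,\emptyset)$; every other correct node keeps a variable $Rec(q)$ per neighbor $q$, and: upon receiving $(m,S)$ from neighbor $q$ with $q\notin S$ and $|S|\le Z-3$, sets $Rec(q):=(m,S)$ and multicasts $(m,S\cup\{q\})$; when there exist $m,p,q,S$ with $q\ne p$, $q\notin S$, $Rec(q)=(m,\emptyset)$, $Rec(p)=(m,S)$, it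 delivers $m$, multicasts $(m,\emptyset)$ and stops.
   Formalization: Messages on a channel are read in sending order, at the receiver's next activation after sending (unbounded transit falsifies the bound); initialization counts as an activation; polygons are circular paths with distinct nodes and no inner chord, i.e. bounded faces. *)

(* Defs.v *)
From mathcomp Require Import all_boot all_order all_algebra.

Set Implicit Arguments.
Unset Strict Implicit.
Unset Printing Implicit Defensive.


(* A simple graph is a symmetric irreflexive relation e : rel V. *)
Definition degree (V : finType) (e : rel V) (x : V) : nat := #|[set y | e x y]|.

Definition max_degree (V : finType) (e : rel V) : nat := \max_(x : V) degree e x.

Definition four_connected (V : finType) (e : rel V) : Prop :=
  forall S : {set V}, #|S| < 4 ->
  forall x y, x \notin S -> y \notin S ->
  connect [rel a b | [&& e a b, a \notin S & b \notin S]] x y.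

Definition walk (V : finType) (e : rel V) (k : nat) (x y : V) : bool :=
  [exists p : k.-tuple V, path e x p && (last x p == y)].

(* Distance in hops.  A shortest walk has fewer than #|V| edges; the default
   value #|V| is only taken when y cannot be reached from x. *)
Definition distance (V : finType) (e : rel V) (x y : V) : nat :=
  \big[minn/#|V|]_(k < #|V| | walk e k x y) k.

Definition diameter (V : finType) (e : rel V) : nat :=
  \max_(x : V) \max_(y : V) distance e x y.


(* A dart is an edge with an orientation.  [rot x] sends each neighbour of x to
   the next one in the cyclic order of the edges drawn around x; faces are the
   orbits of [face_step] on darts, i.e. the contours obtained by following each
   edge and turning onto the next one at its end. *)
Definition darts (V : finType) (e : rel V) : {set V * V} :=
  [set d | e d.1 d.2].

Definition edges (V : finType) (e : rel V) : {set {set V}} :=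
  [set [set d.1; d.2] | d in darts e].

Definition face_step (V : finType) (rot : V -> V -> V) (d : V * V) : V * V :=
  (d.2, rot d.2 d.1).

Definition face (V : finType) (rot : V -> V -> V) (d : V * V) : {set V * V} :=
  [set d' | fconnect (face_step rot) d d'].

Definition faces (V : finType) (e : rel V) (rot : V -> V -> V) :
    {set {set V * V}} :=
  [set face rot d | d in darts e].

(* For a connected graph, a rotation system describes an embedding in the
   sphere exactly when Euler's formula holds; choosing the unbounded face makes
   it an embedding in the plane. *)
Record plane_embedding (V : finType) (e : rel V) := PlaneEmbedding {
  rot : V -> V -> V;
  outer : {set V * V};
  rot_adj : forall x y, e x y -> e x (rot x y);
  rot_cyclic : forall x y z, e x y -> e x z -> fconnect (rot x) y z;
  outer_face : outer \in faces e rot;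
  euler_formula : #|V| + #|faces e rot| = #|edges e| + 2
}.


Definition circular_path (V : finType) (e : rel V) (c : seq V) : bool :=
  [&& 2 < size c, uniq c & cycle e c].

Definition edge_of (V : finType) (c : seq V) (x y : V) : bool :=
  ((x \in c) && (y == next c x)) || ((y \in c) && (x == next c y)).

(* The side of the drawing of c on which a dart lies: stay in the same face, or
   cross an edge that does not belong to c. *)
Definition same_side (V : finType) (rot : V -> V -> V) (c : seq V) :
    rel (V * V) :=
  [rel d d' | (d' == face_step rot d)
              || (d' == (d.2, d.1)) && ~~ edge_of c d.1 d.2].

Definition outside (V : finType) (e : rel V) (emb : plane_embedding e)
    (c : seq V) (d : V * V) : bool :=
  [exists d' in outer emb, connect (same_side (rot emb) c) d d'].

Definition surrounds (V : finType) (e : rel V) (emb : plane_embedding e)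
    (c : seq V) (v : V) : bool :=
  (v \notin c) && [forall w, e v w ==> ~~ outside emb c (v, w)].

Definition inner_chord (V : finType) (e : rel V) (emb : plane_embedding e)
    (c : seq V) (x y : V) : bool :=
  [&& x \in c, y \in c, e x y, ~~ edge_of c x y & ~~ outside emb c (x, y)].

(* A polygon is one cell of the drawing.  Circular paths that surround no node
   but are subdivided by chords must be excluded: a 4-connected planar graph is
   Hamiltonian (Tutte), and a Hamiltonian circuit surrounds no node. *)
Definition polygon (V : finType) (e : rel V) (emb : plane_embedding e)
    (c : seq V) : bool :=
  [&& circular_path e c,
      [forall v, ~~ surrounds emb c v]
    & [forall x, forall y, ~~ inner_chord emb c x y]].

(* The nodes of a circular path are distinct, so its length is at most #|V|. *)
Definition max_polygon_edges (V : finType) (e : rel V)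
    (emb : plane_embedding e) : nat :=
  \max_(n < #|V|.+1 | [exists c : n.-tuple V, polygon emb c]) n.


(* [Raw m] is what the source multicasts, [Tagged m S] is the pair (m, S). *)
Inductive packet (V : finType) (M : Type) :=
  | Raw of M
  | Tagged of M & {set V}.
Arguments Raw {V M}.
Arguments Tagged {V M}.

Inductive state (V : finType) (M : Type) :=
  | Active of (V -> option (M * {set V}))  (* the variables Rec(q) *)
  | Delivered of M.
Arguments Active {V M}.
Arguments Delivered {V M}.

Definition set_rec (V : finType) (M : Type) (rec : V -> option (M * {set V}))
    (q : V) (r : M * {set V}) : V -> option (M * {set V}) :=
  fun x => if x == q then Some r else rec x.

Definition deliverable (V : finType) (M : Type)
    (rec : V -> option (M * {set V})) (m : M) : Prop :=
  exists (p q : V) (S : {set V}), [/\ q != p, q \notin S, rec q = Some (m, set0)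
                  & rec p = Some (m, S)].

(* [receive e s Z p st q k st' out]: the correct node p, distinct from the
   source s, receives the packet k from its neighbour q in state st; it moves to
   state st' and multicasts the packets of out, in this order. *)
Inductive receive (V : finType) (M : Type) (e : rel V) (s : V) (Z : nat)
    (p : V) : state V M -> V -> packet V M -> state V M -> seq (packet V M)
              -> Prop :=
  | receive_stopped m q k :
      receive e s Z p (Delivered m) q k (Delivered m) [::]
  | receive_source rec m :
      e s p ->
      receive e s Z p (Active rec) s (Raw m) (Delivered m) [:: Tagged m set0]
  | receive_wait rec q k :
      e s p -> ~ (q = s /\ exists m, k = Raw m) ->
      receive e s Z p (Active rec) q k (Active rec) [::]
  | receive_forward rec q m (S : {set V}) :
      ~~ e s p -> q \notin S -> #|S| <= Z - 3 ->
      (forall m', ~ deliverable (set_rec rec q (m, S)) m') ->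
      receive e s Z p (Active rec) q (Tagged m S)
        (Active (set_rec rec q (m, S))) [:: Tagged m (q |: S)]
  | receive_deliver rec q m (S : {set V}) m' :
      ~~ e s p -> q \notin S -> #|S| <= Z - 3 ->
      deliverable (set_rec rec q (m, S)) m' ->
      receive e s Z p (Active rec) q (Tagged m S)
        (Delivered m') [:: Tagged m (q |: S); Tagged m' set0]
  | receive_reject rec q m (S : {set V}) :
      ~~ e s p -> ~~ ((q \notin S) && (#|S| <= Z - 3)) ->
      receive e s Z p (Active rec) q (Tagged m S) (Active rec) [::]
  | receive_raw rec q m :
      ~~ e s p ->
      receive e s Z p (Active rec) q (Raw m) (Active rec) [::].

Inductive receive_all (V : finType) (M : Type) (e : rel V) (s : V) (Z : nat)
    (p : V) : state V M -> seq (V * packet V M) -> state V M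
              -> seq (packet V M) -> Prop :=
  | receive_none st : receive_all e s Z p st [::] st [::]
  | receive_cons st q k inbox st1 out1 st2 out2 :
      receive e s Z p st q k st1 out1 ->
      receive_all e s Z p st1 inbox st2 out2 ->
      receive_all e s Z p st ((q, k) :: inbox) st2 (out1 ++ out2).


(* [chan q p] is the FIFO channel from q to p, oldest packet first. *)
Record config (V : finType) (M : Type) := Config {
  node_state : V -> state V M;
  chan : V -> V -> seq (packet V M)
}.

Definition initial (V : finType) (M : Type) (c : config V M) : Prop :=
  (forall p, node_state c p = Active (fun=> None)) /\
  (forall p q, chan c p q = [::]).

(* One activation of p, which reads all its incoming channels, interleaved in
   any order.  If p is correct it obeys the protocol; [bcast] tells whether it
   is, for the source, the activation at which it multicasts m0.  If p is
   Byzantine it sends arbitrary packets to its neighbours. *)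
Definition activation (V : finType) (M : Type) (e : rel V) (s : V) (Z : nat)
    (B : {set V}) (m0 : M) (bcast : bool) (p : V) (c c' : config V M) : Prop :=
  exists (inbox : seq (V * packet V M)) (out : V -> seq (packet V M)),
  [/\ forall q, [seq x.2 | x <- inbox & x.1 == q] = chan c q p,
      forall q r, chan c' q r =
        (if r == p then [::] else chan c q r)
        ++ (if (q == p) && e p r then out r else [::]),
      forall q, q != p -> node_state c' q = node_state c q
    & p \notin B ->
      exists o, (forall r, out r = o) /\
      if p == s then
        if bcast then node_state c' s = Delivered m0 /\ o = [:: Raw m0]
        else node_state c' s = node_state c s /\ o = [::]
      else receive_all e s Z p (node_state c p) inbox (node_state c' p) o].

(* The i-th activation is that of [actor i], occurs at time [date i], and leads
   from [conf i] to [conf i.+1]; times are counted from the initialization. *)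
Record trace (R : realFieldType) (V : finType) (M : Type) := Trace {
  actor : nat -> V;
  date : nat -> R;
  conf : nat -> config V M
}.

(* i0 is the activation at which the source broadcasts m0. *)
Definition execution (R : realFieldType) (V : finType) (M : Type) (e : rel V)
    (s : V) (Z : nat) (B : {set V}) (m0 : M) (i0 : nat) (x : trace R V M) :
    Prop :=
  [/\ initial (conf x 0) /\ actor x i0 = s,
      (0 <= date x 0)%R,
      forall i j, i <= j -> (date x i <= date x j)%R,
      forall p i, exists2 j, i <= j & actor x j = p
    & forall i,
        activation e s Z B m0 (i == i0) (actor x i) (conf x i) (conf x i.+1)].

(* The initialization, at time 0, counts as an activation of every process:
   otherwise nothing would limit the date of the first activation. *)
Definition activation_delay_le (R : realFieldType) (V : finType) (M : Type)
    (T : R) (x : trace R V M) : Prop :=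
  (forall p i j, i < j -> actor x i = p -> actor x j = p ->
     (forall k, i < k < j -> actor x k <> p) ->
     (date x j - date x i <= T)%R) /\
  (forall p j, actor x j = p -> (forall k, k < j -> actor x k <> p) ->
     (date x j <= T)%R).

Definition delivers_by (R : realFieldType) (V : finType) (M : Type)
    (x : trace R V M) (p : V) (m : M) (t : R) : Prop :=
  exists2 i, (date x i <= t)%R
           & forall j, i < j -> node_state (conf x j) p = Delivered m.

(* Main.v *)
Require Import Defs.
From mathcomp Require Import all_boot all_order all_algebra.
From mathcomp Require Import zify ring lra.
Import Defs.

(* The rotation system turns the drawing into a combinatorial map on darts, and
   Euler's formula makes its first cohomology vanish: an edge labelling that sums
   to zero around every face is the difference of a potential on the nodes.  A
   closed curve through at most three nodes and the faces between them is such a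
   labelling, and 4-connectedness makes the potential constant off these nodes,
   so the curve can only turn around one edge or one triangle.

   Hence every face but the outer one is a polygon, at most one Byzantine node
   lies on the polygons around a given node, and the polygons without Byzantine
   node that touch the star of a Byzantine node [b] are linked through shared
   edges: the only obstruction is a contact with the outer face, which is a node
   or an edge when [b] is off that face, and a flow argument shows that both
   sides of the contact are linked.

   A polygon of correct nodes, two of which have delivered, delivers entirely
   within time [Z^2 T]: take an arc of nodes that have not, between two that have
   delivered; the messages travelling along it from both ends meet.  A
   Byzantine node cannot forge a message, for the two routes on which a node
   insists would put two Byzantine nodes within distance [Z].  Following
   a shortest path from the source, each step costs at most as many polygons as
   there are darts in a ball of radius [3Z+1], a bound in [Y] and [Z] only. *)

Set Implicit Arguments.
Unset Strict Implicit.
Unset Printing Implicit Defensive.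

Import Order.TTheory GRing.Theory Num.Theory.

(** * Darts, faces and planarity *)

(** No Jordan curve theorem is available for a rotation system, so a curve is recorded only by how
    often it crosses each dart, and Euler's formula enters solely through the vanishing of
    cohomology. 4-connectedness serves a second time through minimum degree four, which tells apart
    darts one, two or three turns away at a node.

    The outer face may have more than [Z] edges, so messages cannot be expected to travel around it,
    and it is an obstacle just like the faces at a Byzantine node. At one node these two obstacles
    could cut the usable faces into two groups; no local argument excludes this, hence a flow count
    over the whole star of the Byzantine node.

    The distance hypothesis acts twice: two polygons meeting at a node bring their Byzantine nodes
    within [Z/2 + Z/2], and a forged pair of records brings two of them within [(Z - 3) + 2].

    The radius [3Z + 1] is one step of the path, [Z] to a Byzantine node, [Z] back to its star, and
    [Z] across a polygon touching that region. Since the path may run through Byzantine nodes, the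
    induction speaks there of their neighbours instead. *)

Section Darts.
Variables (V : finType) (e : rel V) (emb : plane_embedding e).
Hypotheses (e_sym : symmetric e) (e_irr : irreflexive e).

Definition dart (d : V * V) : bool := e d.1 d.2.

Definition eps (d : V * V) : V * V := (d.2, d.1).

(* Extended by the identity outside the darts, so that it is a permutation. *)
Definition nu (d : V * V) : V * V :=
  if dart d then (d.1, Defs.rot emb d.1 d.2) else d.

(** [face_step] made a permutation. Since [phi (eps d) = nu d], the face of [nu d] is the one on the
    other side of the edge [d]. *)
Definition phi (d : V * V) : V * V := nu (eps d).

Definition fc (d : V * V) : {set V * V} := [set d' | fconnect phi d d'].

Lemma epsK : involutive eps.
Proof. by case. Qed.

Lemma eps_inj : injective eps.
Proof. exact: inv_inj epsK. Qed.

Lemma dart_eps d : dart (eps d) = dart d.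
Proof. by rewrite /dart /= e_sym. Qed.

Lemma nu1 d : (nu d).1 = d.1.
Proof. by rewrite /nu; case: ifP. Qed.

Lemma dart_nu d : dart (nu d) = dart d.
Proof. by rewrite /nu; case: ifP => // h; rewrite /dart /= rot_adj. Qed.

Lemma phi1 d : (phi d).1 = d.2.
Proof. by rewrite /phi nu1. Qed.

Lemma dart_phi d : dart (phi d) = dart d.
Proof. by rewrite /phi dart_nu dart_eps. Qed.

Lemma phi_eps d : phi (eps d) = nu d.
Proof. by rewrite /phi epsK. Qed.

(** [rot_cyclic] leads from [rot v y] back to [y], so [y] is itself a value: the map is onto a
    finite set, hence one-to-one. *)
Lemma rot_inj v : {in [set x | e v x] &, injective (Defs.rot emb v)}.
Proof.
apply/imset_injP; apply/eqP; congr #|pred_of_set _|; apply/setP => y.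
rewrite !inE; apply/imsetP/idP => [[x] | vy].
  by rewrite inE => vx ->; apply: rot_adj.
have := iter_findex (rot_cyclic emb (rot_adj emb vy) vy).
move: (findex _ _ _) => n; rewrite -iterSr iterS => E.
exists (iter n (Defs.rot emb v) y) => //; rewrite inE.
by elim: n {E} => //= n IH; apply: rot_adj.
Qed.

Lemma nu_inj : injective nu.
Proof.
move=> d d' E; have dd: dart d = dart d' by rewrite -dart_nu E dart_nu.
have E1: d.1 = d'.1 by rewrite -nu1 E nu1.
move: E; rewrite /nu -dd; case: ifP => // h; rewrite h in dd.
case: d d' E1 h dd => x y [x' y'] /= <- h dd [E].
by congr (_, _); apply: (rot_inj _ _ E); rewrite inE.
Qed.

Lemma phi_inj : injective phi.
Proof. by move=> x y /nu_inj /eps_inj. Qed.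

Lemma nu_connect d d' : dart d -> dart d' -> d.1 = d'.1 -> fconnect nu d d'.
Proof.
case: d d' => x y [x' z] dd dd' /= E; subst x'.
have := iter_findex (rot_cyclic emb (dd : e x y) (dd' : e x z)).
move: (findex _ _ _) => n <-.
elim: n => [|n IH] /=; first exact: connect0.
apply: connect_trans IH _; apply: connect1; rewrite /= /nu /dart /=.
suff ->: e x (iter n (Defs.rot emb x) y) by [].
by elim: n => //= n IH; apply: rot_adj.
Qed.

Lemma iter_nu1 n d : (iter n nu d).1 = d.1.
Proof. by elim: n => //= n IH; rewrite nu1. Qed.

Lemma dart_iter_nu n d : dart (iter n nu d) = dart d.
Proof. by elim: n => //= n IH; rewrite dart_nu. Qed.

Lemma dart_iter_phi n d : dart (iter n phi d) = dart d.
Proof. by elim: n => //= n IH; rewrite dart_phi. Qed.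

Lemma fc_refl d : d \in fc d.
Proof. by rewrite inE connect0. Qed.

Lemma mem_fc d d' : (d' \in fc d) = (fc d' == fc d).
Proof.
apply/idP/eqP => [|<-]; last exact: fc_refl.
rewrite inE => c; apply/setP => z; rewrite !inE.
by apply/esym/(same_connect (fconnect_sym phi_inj)).
Qed.

Lemma fc_phi d : fc (phi d) = fc d.
Proof. by apply/eqP; rewrite -mem_fc inE fconnect1. Qed.

Lemma fc_iter n d : fc (iter n phi d) = fc d.
Proof. by elim: n => //= n IH; rewrite fc_phi. Qed.

Lemma fc_nu d : fc (nu d) = fc (eps d).
Proof. by rewrite -phi_eps fc_phi. Qed.

Lemma dart_fc d d' : d' \in fc d -> dart d' = dart d.
Proof.
by rewrite inE => /iter_findex <-; rewrite dart_iter_phi.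
Qed.

Lemma fc_iterP d d' : d' \in fc d -> exists2 n, n < #|fc d| & d' = iter n phi d.
Proof.
rewrite inE => c; exists (findex phi d d'); last by rewrite iter_findex.
suff ->: #|fc d| = order phi d by apply: findex_max.
by rewrite cardsE.
Qed.

Lemma face_stepE d : dart d -> face_step (Defs.rot emb) d = phi d.
Proof. by move=> dd; rewrite /phi /nu dart_eps dd. Qed.

Lemma faceE d : dart d -> face (Defs.rot emb) d = fc d.
Proof.
move=> dd; have E n : iter n (face_step (Defs.rot emb)) d = iter n phi d.
  by elim: n => //= n ->; rewrite face_stepE // dart_iter_phi.
apply/setP => d'; rewrite !inE; apply/idP/idP => /iter_findex <-.
  by rewrite E fconnect_iter.
by rewrite -E fconnect_iter.
Qed.

Lemma facesE : faces e (Defs.rot emb) = [set fc d | d in darts e].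
Proof. by apply: eq_in_imset => d; rewrite inE; apply: faceE. Qed.

Lemma outerP : exists2 o, dart o & outer emb = fc o.
Proof.
have := outer_face emb; rewrite facesE => /imsetP[o]; rewrite inE => h ->.
by exists o.
Qed.

Lemma fc_outer d : d \in outer emb -> outer emb = fc d.
Proof. by have [o _ ->] := outerP; rewrite mem_fc => /eqP->. Qed.

End Darts.

(** * Consequences of 4-connectedness and of Euler's formula *)

Section Connectivity.
Variables (V : finType) (e : rel V).
Hypotheses (e_sym : symmetric e) (e_irr : irreflexive e).
Hypotheses (e_4conn : four_connected e) (e_deg : 4 <= max_degree e).

Lemma card_gt4 : 4 < #|V|.
Proof.
have [x hx] : exists x, 4 <= degree e x.
  apply/existsP; rewrite -[X in is_true X]negbK negb_exists.
  apply/negP => /forallP h; move: e_deg; rewrite leqNgt => /negP; apply.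
  by rewrite ltnS; apply/bigmax_leqP => x _; rewrite -ltnS ltnNge; apply: h.
apply: leq_ltn_trans hx _; rewrite /degree -[X in _ < X]cardsT.
apply: proper_card; apply/properP; split; first exact: subsetT.
by exists x; rewrite ?inE ?e_irr.
Qed.

(** Fewer than four neighbours would separate [v] from a further node, which exists by
    [card_gt4]. *)
Lemma degree_ge4 v : 4 <= #|[set y | e v y]|.
Proof.
rewrite leqNgt; apply/negP => h.
have [w] : exists w, w \notin v |: [set y | e v y].
  apply/existsP; rewrite -[X in is_true X]negbK negb_exists.
  apply/negP => /forallP h'; have := card_gt4.
  rewrite -cardsT (_ : [set: V] = v |: [set y | e v y]).
    by rewrite cardsU1 ltnNge (leq_trans (leq_add (leq_b1 _) (leqnn _))).
  by apply/setP => z; rewrite [LHS]inE; have := h' z; rewrite negbK => ->.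
rewrite inE negb_or => /andP[]; rewrite !inE => wv wN.
have := e_4conn h (x := v) (y := w); rewrite !inE e_irr => /(_ isT wN).
case/connectP => -[|a p] /=; first by move=> _ E; rewrite E eqxx in wv.
by rewrite !inE => /andP[/and3P[-> _ ]].
Qed.

(** Induction along a path avoiding [S]. With [S := set0] it is plain connectedness; with three
    nodes it makes potentials constant off a curve. *)
Lemma connected_off (S : {set V}) (P : pred V) : #|S| < 4 ->
  (forall x y, x \notin S -> y \notin S -> e x y -> P x -> P y) ->
  forall x y, x \notin S -> y \notin S -> P x -> P y.
Proof.
move=> hS H x y xS yS; have /connectP[p] := e_4conn hS xS yS.
elim: p x xS => [|a p IH] x xS /=; first by move=> _ ->.
by move=> /andP[/and3P[xa _ aS] pth] E Px; apply: (IH a) => //; apply: (H x).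
Qed.

Variable emb : plane_embedding e.
Local Notation nu := (nu emb).
Local Notation phi := (phi emb).
Local Notation dart := (dart e).
Local Notation fc := (fc emb).

Lemma iter_nu_neq i d : dart d -> 0 < i < 4 -> iter i nu d != d.
Proof.
move=> dd /andP[i0 i4]; apply/eqP => E.
have : i < order nu d.
  apply: leq_trans i4 _; apply: leq_trans (degree_ge4 d.1) _.
  have inj : injective (fun y : V => (d.1, y)) by move=> a b [=].
  rewrite -(card_imset _ inj) /order; apply: subset_leq_card.
  apply/subsetP => z /imsetP[y]; rewrite inE => dy ->.
  by rewrite inE; apply: nu_connect.
by move/findex_iter; rewrite E findex0 => E0; rewrite -E0 in i0.
Qed.

Lemma nu_neq d : dart d -> nu d != d.
Proof. by move=> h; apply: (@iter_nu_neq 1). Qed.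

Lemma dart_at v : exists y, e v y.
Proof.
apply/existsP; have : 0 < #|[set y | e v y]| by apply: leq_trans (degree_ge4 v).
by case/card_gt0P => y; rewrite inE => h; apply/existsP; exists y.
Qed.

(** [nu] reaches all darts at a node and [eps] passes to the neighbours, so together they reach
    every dart of a connected graph. *)
Lemma dart_ind (Q : pred (V * V)) :
  (forall d, dart d -> Q d -> Q (nu d)) ->
  (forall d, dart d -> Q d -> Q (eps d)) ->
  forall d d', dart d -> dart d' -> Q d -> Q d'.
Proof.
move=> Hn He.
have Hv d d' : dart d -> dart d' -> d.1 = d'.1 -> Q d -> Q d'.
  move=> dd dd' E; have /iter_findex <- := nu_connect emb dd dd' E.
  by elim: (findex _ _ _) => //= n IH /IH; apply: Hn; rewrite dart_iter_nu.
move=> d d' dd dd' Qd.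
pose P v := [forall y, e v y ==> Q (v, y)].
suff /forallP/(_ d'.2)/implyP : P d'.1 by rewrite -surjective_pairing; apply.
apply: (@connected_off set0 P _ _ d.1); rewrite ?cards0 ?inE //.
  move=> x y _ _ xy /forallP Px; apply/forallP => z; apply/implyP => yz.
  apply: (Hv (eps (x, y))) => //; first by rewrite dart_eps.
  by apply: He => //; apply: (implyP (Px y)).
by apply/forallP => z; apply/implyP => dz; apply: Hv Qd.
Qed.

Lemma card_darts : #|darts e| = #|edges e|.*2.
Proof.
rewrite -sum1_card (partition_big_imset (fun d : V * V => [set d.1; d.2])) /=.
rewrite -[in RHS]sum1_card -mul2n big_distrr /=; apply: eq_bigr => E.
case/imsetP => d; rewrite inE => dd ->.
rewrite (bigD1 d) ?inE ?dd ?eqxx //= (bigD1 (eps d)) /=; last first.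
  rewrite inE /= e_sym dd setUC eqxx /=.
  by case: d dd => x y dd; apply: contraTneq dd => -[->]; rewrite /= e_irr.
rewrite big1 // => d' /andP[/andP[/andP[]]]; rewrite inE.
case: d d' dd => x y [x' y'] /= xy xy' /eqP E1 n1 n2; exfalso.
have: x' \in [set x; y] by rewrite -E1 !inE eqxx.
have: y' \in [set x; y] by rewrite -E1 !inE eqxx orbT.
rewrite !inE => /orP[]/eqP Ey /orP[]/eqP Ex; subst x' y';
  by move: n1 n2 xy'; rewrite /eps /= ?eqxx ?e_irr.
Qed.

(** * Rank count for dart labellings *)

Local Open Scope ring_scope.

(** Row vectors indexed by darts are dart labellings. The row space of [bd] is made of the
    coboundaries; being killed by [fm] means summing to zero around every face, and being killed by
    [em] means being antisymmetric. *)
Let bd : 'M[rat]_(#|V|, #|darts e|) := \matrix_(i < #|V|, j < #|darts e|)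
  (((enum_val j).2 == enum_val i)%:R - ((enum_val j).1 == enum_val i)%:R).
Let fm : 'M[rat]_(#|darts e|, #|faces e (Defs.rot emb)|) :=
  \matrix_(j < #|darts e|, k < #|faces e (Defs.rot emb)|) (enum_val j \in enum_val k)%:R.
Let em : 'M[rat]_(#|darts e|, #|edges e|) :=
  \matrix_(j < #|darts e|, k < #|edges e|) ([set (enum_val j).1; (enum_val j).2] == enum_val k)%:R.

Lemma sum_pick (T : finType) (A : {pred T}) (u : 'I_#|A| -> rat) x (xA : x \in A) :
  \sum_i u i * (x == enum_val i)%:R = u (enum_rank_in xA x).
Proof.
rewrite (bigD1 (enum_rank_in xA x)) //= enum_rankK_in // eqxx mulr1 big1 ?addr0 //.
move=> i ni; case: (x =P enum_val i) => [E|_]; last by rewrite mulr0.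
by case/eqP: ni; apply: enum_val_inj; rewrite enum_rankK_in.
Qed.

Lemma sum_rank (u : 'I_#|V| -> rat) x :
  \sum_i u i * (x == enum_val i)%:R = u (enum_rank x).
Proof.
rewrite (bigD1 (enum_rank x)) //= enum_rankK eqxx mulr1 big1 ?addr0 //.
move=> i ni; case: (x =P enum_val i) => [E|_]; last by rewrite mulr0.
by case/eqP: ni; rewrite E enum_valK.
Qed.

(** A row vector killed by [bd] agrees at both ends of every edge, so it is constant and the left
    kernel is at most a line. *)
Lemma rank_bd : (#|V|.-1 <= \rank bd)%N.
Proof.
suff : (\rank (kermx bd) <= 1)%N by rewrite mxrank_ker; lia.
suff /mxrankS h : (kermx bd <= (const_mx 1 : 'rV_#|V|))%MS.
  exact: leq_trans h (rank_leq_row _).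
apply/row_subP => i; set u := row i _.
have : u *m bd = 0 by rewrite /u -row_mul mulmx_ker row0.
move: {i} u => u /rowP E.
have Eu d : dart d -> u 0 (enum_rank d.1) = u 0 (enum_rank d.2).
  move=> dd; have dD : d \in darts e by rewrite inE.
  have := E (enum_rank_in dD d); rewrite !mxE.
  under eq_bigr => i _ do rewrite mxE enum_rankK_in // mulrBr.
  rewrite sumrB.
  by rewrite !sum_rank => /eqP; rewrite subr_eq0 => /eqP.
have [o oo _] := outerP emb e_sym; pose v := o.1.
suff -> : u = u 0 (enum_rank v) *: const_mx 1 by apply: scalemx_sub.
apply/rowP => i; rewrite !mxE mulr1 -[i]enum_valK; apply/eqP.
apply: (@connected_off set0 (fun x => u 0 (enum_rank x) == u 0 (enum_rank v)) _ _ v);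
  rewrite ?cards0 ?inE //.
by move=> x y _ _ xy /eqP <-; rewrite -(Eu (x, y)).
Qed.

Lemma enum_val_face (k : 'I_#|faces e (Defs.rot emb)|) :
  exists2 d, dart d & enum_val k = fc d.
Proof.
have : enum_val k \in [set fc d | d in darts e].
  by rewrite -facesE //; apply: enum_valP.
by case/imsetP => d; rewrite inE => dd ->; exists d.
Qed.

(** A relation between the columns is a weight [y] on faces and [z] on edges with [y + z = 0] at
    every dart. Both darts of an edge share [z], so [y] agrees across edges and is constant by
    [dart_ind]: there is at most one relation. *)
Lemma rank_fe : (#|faces e (Defs.rot emb)| + #|edges e| - 1 <= \rank (row_mx fm em))%N.
Proof.
suff : (\rank (kermx (row_mx fm em)^T) <= 1)%N.
  by rewrite mxrank_ker mxrank_tr !leq_subLR [(_ + 1)%N]addnC.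
set w0 := row_mx (const_mx 1 : 'rV[rat]_#|faces e (Defs.rot emb)|)
                 (const_mx (-1) : 'rV[rat]_#|edges e|).
suff /mxrankS h : (kermx (row_mx fm em)^T <= w0)%MS.
  exact: leq_trans h (rank_leq_row _).
apply/row_subP => i; set u := row i _.
have : u *m (row_mx fm em)^T = 0 by rewrite /u -row_mul mulmx_ker row0.
move: {i} u => u; rewrite tr_row_mx -[u]hsubmxK mul_row_col => /rowP E.
have fD d : dart d -> fc d \in faces e (Defs.rot emb).
  by move=> dd; rewrite facesE //; apply: imset_f; rewrite inE.
have eD (d : V * V) : dart d -> [set d.1; d.2] \in edges e.
  by move=> dd; apply: imset_f; rewrite inE.
have Eu d (dd : dart d) :
   lsubmx u 0 (enum_rank_in (fD d dd) (fc d)) + 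
   rsubmx u 0 (enum_rank_in (eD d dd) [set d.1; d.2]) = 0.
  have dD : d \in darts e by rewrite inE.
  have := E (enum_rank_in dD d); rewrite mxE [X in X + _]mxE [X in _ + X]mxE [RHS]mxE => <-.
  congr (_ + _).
    rewrite -sum_pick; apply: eq_bigr => i _; rewrite !mxE enum_rankK_in //.
    congr (_ * _%:R); have [d' dd' ->] := enum_val_face i.
    by rewrite mem_fc.
  by rewrite -sum_pick; apply: eq_bigr => i _; rewrite !mxE enum_rankK_in.
have [o oo _] := outerP emb e_sym.
pose y d := lsubmx u 0 (enum_rank_in (fD o oo) (fc d)).
pose z d := rsubmx u 0 (enum_rank_in (eD o oo) [set d.1; d.2]).
have Eyz d : dart d -> y d + z d = 0.
  move=> dd; rewrite -[RHS](Eu d dd); congr (lsubmx u 0 _ + rsubmx u 0 _);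
  by apply: enum_val_inj; rewrite !enum_rankK_in ?fD ?eD.
have Eye d : dart d -> y (eps d) = y d.
  move=> dd; apply: (@addIr _ (z d)); rewrite Eyz //.
  have -> : z d = z (eps d) by congr (rsubmx u 0 (enum_rank_in _ _)); apply: setUC.
  by rewrite Eyz // dart_eps.
have Ey d : dart d -> y d = y o.
  move=> dd; apply/eqP; apply: (@dart_ind (fun d => y d == y o) _ _ o) => //.
    by move=> d' dd' /eqP <-; rewrite -(Eye d') // /y fc_nu.
  by move=> d' dd' /eqP <-; rewrite Eye.
have -> : row_mx (lsubmx u) (rsubmx u) = y o *: w0.
  rewrite scale_row_mx; congr row_mx; apply/rowP => i; rewrite !mxE ?mulrN mulr1.
    have [d dd Ed] := enum_val_face i.
    by rewrite -(Ey d dd) /y -Ed enum_valK_in mxE.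
  have := enum_valP i => /imsetP[d]; rewrite inE => dd Ed.
  rewrite -(Ey d dd); have /eqP := Eyz d dd.
  by rewrite addrC addr_eq0 => /eqP <-; rewrite /z -Ed enum_valK_in mxE.
exact: scalemx_sub.
Qed.

Lemma bd_fe : bd *m row_mx fm em = 0.
Proof.
rewrite mul_mx_row -[RHS]row_mx0; congr row_mx; apply/matrixP => i k; rewrite !mxE.
  under eq_bigr => j _ do rewrite !mxE mulrBl -!natrM !mulnb.
  rewrite -(big_enum_val (fun d : V * V => ((d.2 == enum_val i) && (d \in enum_val k))%:R -
     ((d.1 == enum_val i) && (d \in enum_val k))%:R)) /= sumrB; apply/eqP.
  rewrite subr_eq0 [eqbRHS](reindex_inj (@phi_inj _ _ emb)) /=; apply/eqP.
  apply: eq_big => [d|d _]; first by rewrite !inE -!/(dart _) dart_phi.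
  rewrite phi1; congr (_ && _)%:R.
  have [d' _ ->] := enum_val_face k.
  by rewrite !mem_fc // fc_phi.
under eq_bigr => j _ do rewrite !mxE mulrBl -!natrM !mulnb.
rewrite -(big_enum_val (fun d : V * V =>
     ((d.2 == enum_val i) && ([set d.1; d.2] == enum_val k))%:R -
     ((d.1 == enum_val i) && ([set d.1; d.2] == enum_val k))%:R)) /= sumrB; apply/eqP.
rewrite subr_eq0 [eqbRHS](reindex_inj (@eps_inj V)) /=; apply/eqP.
apply: eq_big => [d|d _]; first by rewrite !inE e_sym.
by rewrite [in RHS]setUC.
Qed.

(* The first cohomology of the sphere vanishes.  Coboundaries are cocycles, and
   Euler's formula makes the two spaces have the same dimension. *)
Lemma cocycle_potential (c : V * V -> rat) :
  (forall d, dart d -> c (eps d) = - c d) ->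
  (forall d, dart d -> \sum_(d' in fc d) c d' = 0) ->
  exists A : V -> rat, forall d, dart d -> c d = A d.2 - A d.1.
Proof.
move=> anti clos; pose C : 'rV[rat]_#|darts e| := \row_j c (enum_val j).
have : (C <= kermx (row_mx fm em))%MS.
  apply/sub_kermxP; rewrite mul_mx_row -[RHS]row_mx0; congr row_mx;
    apply/rowP => k; rewrite !mxE.
    under eq_bigr => j _ do rewrite !mxE.
    rewrite -(big_enum_val (fun d => c d * (d \in enum_val k)%:R)) /=.
    have [d dd ->] := enum_val_face k.
    rewrite -[RHS](clos d dd) [RHS]big_mkcond [LHS]big_mkcond; apply: eq_bigr => d' _.
    case: ifP => h1; case: ifP => h2; rewrite ?mulr1 ?mulr0 //.
    by move: h1; rewrite inE -/(dart _) (dart_fc _ h2) // (dd : is_true (dart d)).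
  under eq_bigr => j _ do rewrite !mxE.
  rewrite -(big_enum_val (fun d : V * V => c d * ([set d.1; d.2] == enum_val k)%:R)) /=.
  set s := \sum_(_ in _) _; suff : s = - s by lra.
  rewrite {1}/s (reindex_inj (@eps_inj V)) -sumrN; apply: eq_big => [d|d].
    by rewrite !inE e_sym.
  by rewrite inE /= e_sym => dd; rewrite anti // setUC mulNr.
have : (kermx (row_mx fm em) <= bd)%MS.
  have h : (bd <= kermx (row_mx fm em))%MS by apply/sub_kermxP/bd_fe.
  rewrite -(mxrank_leqif_sup h) eqn_leq (mxrankS h) /= mxrank_ker.
  (* Cocycles have dimension at most [2n - (f + n - 1)], which Euler's formula turns into [v - 1],
     the lower bound for coboundaries. *)
  have arith (v f n d r r' : nat) : (v + f = n + 2 -> d = n.*2 -> v.-1 <= r ->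
    f + n - 1 <= r' -> d - r' <= r)%N by lia.
  exact: arith (euler_formula emb) card_darts rank_bd rank_fe.
move=> h1 h2; have /submxP[u Eu] := submx_trans h2 h1.
exists (fun v => u 0 (enum_rank v)) => d dd; have dD : d \in darts e by rewrite inE.
have := congr1 (fun M : 'rV_#|darts e| => M 0 (enum_rank_in dD d)) Eu.
rewrite !mxE enum_rankK_in // => ->.
under eq_bigr => i _ do rewrite mxE enum_rankK_in // mulrBr.
rewrite sumrB.
by rewrite !sum_rank.
Qed.

(** Off [S] the potential does not change along edges and the graph stays connected; subtracting the
    common value normalizes it. *)
Lemma cocycle_potential_off (S : {set V}) (c : V * V -> rat) : (#|S| < 4)%N ->
  (forall d, dart d -> c (eps d) = - c d) ->
  (forall d, dart d -> \sum_(d' in fc d) c d' = 0) ->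
  (forall d, d.1 \notin S -> d.2 \notin S -> c d = 0) ->
  exists A : V -> rat, (forall d, dart d -> c d = A d.2 - A d.1) /\
    (forall v, v \notin S -> A v = 0).
Proof.
move=> hS anti clos supp; have [A HA] := cocycle_potential anti clos.
have [w wS] : exists w, w \notin S.
  apply/existsP; rewrite -[X in is_true X]negbK negb_exists.
  apply/negP => /forallP h'; have := leq_trans hS (ltnW card_gt4).
  rewrite -cardsT ltnNge => /negP; apply; apply: subset_leq_card.
  by apply/subsetP => z _; have := h' z; rewrite negbK.
exists (fun v => A v - A w); split => [d dd|v vS].
  by rewrite HA //; ring.
apply/eqP; rewrite subr_eq0.
apply: (@connected_off S (fun v => A v == A w) hS _ w v wS vS (eqxx _)).
move=> x y xS yS xy /eqP <-.
by have := HA (x, y) xy; rewrite supp //= => /eqP; rewrite eq_sym subr_eq0.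
Qed.

End Connectivity.

(** * Closed curves through few nodes *)

Section RadialCurves.
Variables (V : finType) (e : rel V) (emb : plane_embedding e).
Hypotheses (e_sym : symmetric e) (e_irr : irreflexive e).
Hypotheses (e_4conn : four_connected e) (e_deg : 4 <= max_degree e).
Local Notation nu := (nu emb).
Local Notation phi := (phi emb).
Local Notation dart := (dart e).
Local Notation fc := (fc emb).

(* [a] counts how often a curve crosses the darts at [v] when it turns around
   [v] from the corner before [d] to the corner before [d']. *)
Definition arc (a : V * V -> nat) (v : V) (d d' : V * V) : Prop :=
  (forall x, a (nu x) + (nu x == d') = a x + (nu x == d)) /\
  (forall x, x.1 != v -> a x = 0).

Definition inc (v : V) (d : V * V) : bool := v \in [set d'.1 | d' in fc d].

Lemma incP v d : reflect (exists2 d', d'.1 = v & fc d' = fc d) (inc v d).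
Proof.
apply: (iffP imsetP) => [[d' h ->]|[d' <- E]]; exists d' => //.
  by apply/eqP; rewrite -mem_fc.
by rewrite mem_fc E.
Qed.

Lemma inc_fc v d d' : fc d = fc d' -> inc v d = inc v d'.
Proof. by rewrite /inc => ->. Qed.

Lemma inc1 d : inc d.1 d.
Proof. by apply/incP; exists d. Qed.

Lemma inc2 d : inc d.2 d.
Proof. by apply/incP; exists (phi d); rewrite ?fc_phi ?phi1. Qed.

Lemma nu_pred d : exists p, [/\ nu p = d, dart p = dart d & p.1 = d.1].
Proof.
exists (finv nu d); have E : nu (finv nu d) = d by apply: f_finv (@nu_inj _ _ emb) _.
by rewrite -[in dart d]E -[in d.1]E dart_nu nu1 E.
Qed.

Lemma arc_exists d d' : dart d -> dart d' -> d.1 = d'.1 -> exists a, arc a d.1 d d'.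
Proof.
move=> dd dd' E; have /iter_findex <- := nu_connect emb dd dd' E.
move: (findex _ _ _) => k; exists (fun x => \sum_(i < k) (x == iter i nu d)).
split => [x|x nx]; last first.
  by rewrite big1 // => i _; case: (x =P _) nx => [->|//]; rewrite iter_nu1 eqxx.
have <- : \sum_(i < k.+1) (nu x == iter i nu d) =
  \sum_(i < k) (nu x == iter i nu d) + (nu x == iter k nu d) by rewrite big_ord_recr.
rewrite big_ord_recl addnC /=; congr addn.
by apply: eq_bigr => i _; rewrite /= (inj_eq (@nu_inj _ _ emb)).
Qed.

Lemma arc_trivial v d : arc (fun=> 0) v d d.
Proof. by []. Qed.

Local Open Scope ring_scope.

(** The jump equation at [eps x], where [nu (eps x) = phi x], makes the sum telescope around a face
    except where the arc starts or ends. Arcs chained through common faces into a closed curve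
    therefore give a cocycle. *)
Lemma arc_face_sum a v d d' f : arc a v d d' ->
  \sum_(x in fc f) ((a x)%:R - (a (eps x))%:R) =
  (fc d == fc f)%:R - (fc d' == fc f)%:R :> rat.
Proof.
case=> J _; rewrite -!mem_fc.
have sumE (x : V * V) : \sum_(z in fc f) (phi z == x)%:R = (x \in fc f)%:R :> rat.
  rewrite (reindex_inj (finv_inj (@phi_inj _ _ emb))) /=.
  under eq_bigr => z _ do rewrite (f_finv (@phi_inj _ _ emb)).
  under eq_bigl => z do rewrite mem_fc -(fc_phi _ (finv _ z)) (f_finv (@phi_inj _ _ emb)) -mem_fc.
  rewrite big_mkcond (bigD1 x) //= eqxx big1 ?addr0; first by case: ifP.
  by move=> z /negPf ->; rewrite if_same.
rewrite -!sumE; apply/eqP; rewrite -subr_eq0 -!sumrB.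
have -> : \sum_(x in fc f) ((a x)%:R - (a (eps x))%:R - ((phi x == d)%:R - (phi x == d')%:R)) =
  \sum_(x in fc f) (a x)%:R - \sum_(x in fc f) (a (phi x))%:R :> rat.
  rewrite -sumrB; apply: eq_bigr => x _; have /(congr1 (fun n => n%:R : rat)) := J (eps x).
  by rewrite !natrD -/(phi x) => E; lra.
rewrite subr_eq0 [eqbLHS](reindex_inj (@phi_inj _ _ emb)); apply/eqP; apply: eq_bigl => x.
by rewrite !mem_fc fc_phi.
Qed.

(** The arcs, joined inside their common faces, form a closed curve. Curves through fewer nodes use
    [arc_trivial] for the missing arcs. *)
Lemma radial_potential a1 a2 a3 v1 v2 v3 d1 d2 d3 d1' d2' d3' :
  arc a1 v1 d1 d1' -> arc a2 v2 d2 d2' -> arc a3 v3 d3 d3' ->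
  fc d1' = fc d2 -> fc d2' = fc d3 -> fc d3' = fc d1 ->
  exists A : V -> rat, (forall v, v \notin [set v1; v2; v3] -> A v = 0) /\
  forall d, dart d ->
    (a1 d + a2 d + a3 d)%:R - (a1 (eps d) + a2 (eps d) + a3 (eps d))%:R = A d.2 - A d.1.
Proof.
move=> A1 A2 A3 E1 E2 E3.
pose c d : rat := (a1 d + a2 d + a3 d)%:R - (a1 (eps d) + a2 (eps d) + a3 (eps d))%:R.
have [] := @cocycle_potential_off _ _ e_sym e_irr e_4conn e_deg emb [set v1; v2; v3] c.
- rewrite -setUA; apply: leq_ltn_trans (leq_card_setU _ _) _.
  by rewrite cards1 cards2; case: eqP.
- by move=> d _; rewrite /c epsK opprB.
- move=> f _; have := arc_face_sum f A1; have := arc_face_sum f A2.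
  have := arc_face_sum f A3; rewrite E1 E2 E3 => h3 h2 h1.
  transitivity (\sum_(x in fc f) ((a1 x)%:R - (a1 (eps x))%:R) +
    \sum_(x in fc f) ((a2 x)%:R - (a2 (eps x))%:R) +
    \sum_(x in fc f) ((a3 x)%:R - (a3 (eps x))%:R) : rat); last by rewrite h1 h2 h3; ring.
  by rewrite -!big_split; apply: eq_bigr => x _; rewrite /c !natrD /=; ring.
- move=> d; rewrite !inE !negb_or => /andP[/andP[n1 n2] n3] /andP[/andP[n1' n2'] n3'].
  case: A1 A2 A3 => _ Z1 [_ Z2] [_ Z3]; rewrite /c.
  by rewrite !Z1 ?Z2 ?Z3 // subrr.
by move=> A [HA HA']; exists A.
Qed.

(** Otherwise a closed curve passes through this node and this face alone. All neighbours lie off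
    it, so [a] takes one value on all darts at the node, although it jumps at [d]. *)
Lemma face_simple d d' : dart d -> dart d' -> d.1 = d'.1 -> fc d = fc d' -> d = d'.
Proof.
move=> dd dd' E F; apply/eqP/negPn/negP => ne.
have [a Ha] := arc_exists dd dd' E.
have [A [A0 HA]] := radial_potential Ha (arc_trivial d.1 d') (arc_trivial d.1 d')
  erefl erefl (esym F).
have Ea x : dart x -> x.1 = d.1 -> (a x)%:R = - A d.1.
  move=> dx Ex; have := HA x dx; case: Ha => _ Z.
  have nx : x.2 != d.1 by apply: contraTneq dx => nx; rewrite /dart Ex nx e_irr.
  rewrite !addn0 (Z (eps x)) // Ex A0; last by rewrite !inE !negb_or nx.
  by rewrite subr0 sub0r.
have [p [Ep dp Ep1]] := nu_pred d.
case: Ha => J _; have := J p; rewrite Ep eqxx (negPf ne) addn0 addn1.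
by move/(congr1 (fun n => n%:R : rat)); rewrite -natr1 !Ea // ?dp //; lra.
Qed.

(** A dart from [v1] to a node off the curve is crossed by the first arc only, and the potential
    vanishes at its far end, which leaves [- A v1]. *)
Lemma radial_uniform a1 a2 a3 v1 v2 v3 d1 d2 d3 d1' d2' d3' :
  arc a1 v1 d1 d1' -> arc a2 v2 d2 d2' -> arc a3 v3 d3 d3' ->
  fc d1' = fc d2 -> fc d2' = fc d3 -> fc d3' = fc d1 ->
  v1 != v2 -> v1 != v3 ->
  exists t : rat, forall d, dart d -> d.1 = v1 -> d.2 != v2 -> d.2 != v3 -> (a1 d)%:R = t.
Proof.
move=> A1 A2 A3 E1 E2 E3 n2 n3; have [A [A0 HA]] := radial_potential A1 A2 A3 E1 E2 E3.
exists (- A v1) => d dd Ed m2 m3; have := HA d dd.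
have m1 : d.2 != v1 by apply: contraTneq dd => E; rewrite /dart Ed E e_irr.
case: A1 A2 A3 => _ Z1 [_ Z2] [_ Z3].
have -> : a2 d = 0%N by apply: Z2; rewrite Ed.
have -> : a3 d = 0%N by apply: Z3; rewrite Ed.
rewrite (Z1 (eps d)) // (Z2 (eps d)) // (Z3 (eps d)) // Ed A0.
  by rewrite !addn0 subr0 sub0r.
by rewrite !inE !negb_or m1 m2.
Qed.

Lemma dart_ext d d' : d.1 = d'.1 -> d.2 = d'.2 -> d = d' :> V * V.
Proof. by case: d d' => ? ? [? ?] /= -> ->. Qed.

(** A curve through two nodes surrounds at most the edge between them: crossings at the first node
    are uniform except at the dart to the second, so both jumps are next to that dart. *)
Lemma two_faces d1 d1' d2 d2' :
  dart d1 -> dart d1' -> dart d2 -> dart d2' ->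
  d1.1 = d1'.1 -> d2.1 = d2'.1 -> d1.1 != d2.1 ->
  fc d1' = fc d2 -> fc d2' = fc d1 -> fc d1 != fc d1' ->
  (d1 = (d1.1, d2.1) /\ d1' = nu d1) \/ (d1' = (d1.1, d2.1) /\ d1 = nu d1').
Proof.
move=> dd1 dd1' dd2 dd2' E1 E2 nv F1 F2 nF.
have nd : d1 != d1' by apply: contraNneq nF => ->.
have [a1 A1] := arc_exists dd1 dd1' E1; have [a2 A2] := arc_exists dd2 dd2' E2.
have [t Ht] := radial_uniform A1 A2 (arc_trivial d2.1 d2') F1 erefl F2 nv nv.
have {}Ht x : dart x -> x.1 = d1.1 -> (a1 x)%:R != t -> x = (d1.1, d2.1).
  move=> dx Ex nx; apply: dart_ext => //=; apply/eqP; apply: contraNT nx => nx.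
  by rewrite Ht.
have nn x : dart x -> x.1 = d1.1 -> x = (d1.1, d2.1) -> nu x <> (d1.1, d2.1).
  by move=> dx _ <- /eqP; rewrite (negPf (nu_neq e_irr e_4conn e_deg emb dx)).
case: A1 => J _; case: (eqVneq (a1 d1)%:R t) => [E|n].
  right; have [p [Ep dp p1]] := nu_pred d1; rewrite dd1 in dp.
  have np : (a1 p)%:R != t.
    apply/eqP => E'; have := J p; rewrite Ep eqxx (negPf nd) addn0 addn1.
    by move/(congr1 (fun n => n%:R : rat)); rewrite -natr1 E E'; lra.
  have Epp := Ht p dp p1 np.
  have [<-|npd] := eqVneq p d1'; first by rewrite Ep.
  have [q [Eq dq q1]] := nu_pred p; rewrite dp in dq; rewrite p1 in q1.
  case: (nn q dq q1 (Ht q dq q1 _)); last by rewrite Eq.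
  have := J q; rewrite Eq (negPf npd) -[in X in _ = X]Ep eq_sym.
  by rewrite (negPf (nu_neq e_irr e_4conn e_deg emb dp)) !addn0 => <-.
left; have Ed := Ht d1 dd1 erefl n; split=> //.
apply/eqP; rewrite eq_sym; apply: contraT => nd'.
case: (nn d1 dd1 erefl Ed); apply: Ht; rewrite ?dart_nu ?nu1 //.
have := J d1; rewrite (negPf nd') (negPf (nu_neq e_irr e_4conn e_deg emb dd1)) !addn0.
by move=> ->.
Qed.

(** Crossings at [dv.1] deviate only at the darts to [dx.1] and [db.1]. The jump at [dv] cannot come
    from the dart to [db.1], which is off the face of [dv]; so it comes from an edge to [dx.1], and
    following the crossings up to the other jump finds [db.1] on its far side. *)
Lemma three_faces dv dv' dx dx' db db' :
  dart dv -> dart dv' -> dart dx -> dart dx' -> dart db -> dart db' ->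
  dv.1 = dv'.1 -> dx.1 = dx'.1 -> db.1 = db'.1 ->
  dv.1 != dx.1 -> dv.1 != db.1 ->
  fc dv' = fc db -> fc db' = fc dx -> fc dx' = fc dv -> ~~ inc db.1 dv ->
  let d := (dv.1, dx.1) in
  dart d /\ ((dv = d /\ inc db.1 (nu d)) \/ (dv = nu d /\ inc db.1 d)).
Proof.
move=> ddv ddv' ddx ddx' ddb ddb' Ev Ex Eb nvx nvb Fvb Fbx Fxv nb d.
have nd : dv != dv'.
  by apply: contraNneq nb => E; rewrite (inc_fc _ (congr1 fc E)) (inc_fc _ Fvb) inc1.
have [a1 A1] := arc_exists ddv ddv' Ev; have [a2 A2] := arc_exists ddb ddb' Eb.
have [a3 A3] := arc_exists ddx ddx' Ex.
have [t Ht] := radial_uniform A1 A2 A3 Fvb Fbx Fxv nvb nvx.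
have {}Ht x : dart x -> x.1 = dv.1 -> (a1 x)%:R != t -> x.2 = db.1 \/ x = d.
  move=> dx1 Ex1 nx; case: (eqVneq x.2 db.1) => [|n1]; [by left|right].
  by apply: dart_ext => //=; apply/eqP; apply: contraNT nx => nx; rewrite Ht.
have nuD x (dx1 : dart x) := negPf (nu_neq e_irr e_4conn e_deg emb dx1).
have incn x : x.2 = db.1 -> inc db.1 (nu x).
  by move=> E; rewrite (inc_fc _ (fc_nu _ x)) -E; apply: inc1.
case: A1 => J _; case: (eqVneq (a1 dv)%:R t) => [E|n].
  have [p [Ep dp p1]] := nu_pred dv; rewrite ddv in dp.
  have np : (a1 p)%:R != t.
    apply/eqP => E'; have := J p; rewrite Ep eqxx (negPf nd) addn0 addn1.
    by move/(congr1 (fun n => n%:R : rat)); rewrite -natr1 E E'; lra.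
  case: (Ht p dp p1 np) => [Epp|Epp].
    by case/negP: nb; rewrite -Ep; apply: incn.
  split; first by rewrite -Epp.
  right; rewrite -Epp Ep; split=> //.
  have [->|npd] := eqVneq p dv'; first by rewrite (inc_fc _ Fvb) inc1.
  have [q [Eq dq q1]] := nu_pred p; rewrite dp in dq; rewrite p1 in q1.
  have nq : (a1 q)%:R != t.
    have := J q; rewrite Eq (negPf npd) -[in X in _ = X]Ep eq_sym nuD //.
    by rewrite !addn0 => <-.
  case: (Ht q dq q1 nq) => [Eqq|Eqq]; first by rewrite -Eq; apply: incn.
  by have := nuD q dq; rewrite Eq Epp Eqq eqxx.
case: (Ht dv ddv erefl n) => [Ed|Ed].
  by case/negP: nb; rewrite -Ed; apply: inc2.
split; first by rewrite -Ed.
left; split=> //; rewrite -Ed.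
have [->|npd] := eqVneq (nu dv) dv'; first by rewrite (inc_fc _ Fvb) inc1.
have nq : (a1 (nu dv))%:R != t.
  by have := J dv; rewrite (negPf npd) nuD // !addn0 => ->.
case: (Ht (nu dv) _ _ nq); rewrite ?dart_nu ?nu1 // => Eq.
  by rewrite -Eq; apply: inc2.
by have := nuD dv ddv; rewrite Eq Ed eqxx.
Qed.

End RadialCurves.

(** * Inner faces are polygons *)

Section FaceSize.
Variables (V : finType) (e : rel V) (emb : plane_embedding e).
Hypotheses (e_sym : symmetric e) (e_irr : irreflexive e).
Hypotheses (e_4conn : four_connected e) (e_deg : 4 <= max_degree e).
Local Notation nu := (nu emb).
Local Notation phi := (phi emb).
Local Notation dart := (dart e).
Local Notation fc := (fc emb).
Local Notation inc := (inc emb).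
Local Notation simple := (@face_simple _ _ emb e_sym e_irr e_4conn e_deg).

Section InnerFace.
Variable d0 : V * V.
Hypotheses (dd0 : dart d0) (inner : fc d0 != outer emb).

Let c := [seq x.1 | x <- orbit phi d0].

Let mem_orbit_fc x : (x \in orbit phi d0) = (x \in fc d0).
Proof. by rewrite inE fconnect_orbit. Qed.

Let fcD x : x \in fc d0 -> dart x.
Proof. by move/(dart_fc e_sym) ->. Qed.

Let fcPhi x : (phi x \in fc d0) = (x \in fc d0).
Proof. by rewrite !mem_fc fc_phi. Qed.

Let simple0 x y : x \in fc d0 -> y \in fc d0 -> x.1 = y.1 -> x = y.
Proof.
move=> hx hy E; apply: (simple (fcD hx) (fcD hy) E).
by move: hx hy; rewrite !mem_fc => /eqP-> /eqP->.
Qed.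

Let mem_c x : reflect (exists y, (x, y) \in fc d0) (x \in c).
Proof.
apply: (iffP mapP) => [[[x' y] h ->]|[y h]].
  by exists y; rewrite -mem_orbit_fc.
by exists (x, y); rewrite ?mem_orbit_fc.
Qed.

Lemma size_contour : size c = #|fc d0|.
Proof. by rewrite size_map size_orbit cardsE. Qed.

Lemma contour_uniq : uniq c.
Proof.
rewrite map_inj_in_uniq ?orbit_uniq // => x y.
by rewrite !mem_orbit_fc; apply: simple0.
Qed.

Let contour_cycle : cycle [rel x y | (x, y) \in fc d0] c.
Proof.
rewrite /c cycle_map; apply: (sub_in_cycle (P := mem (fc d0)) (e := frel phi)).
- move=> x y hx hy /= /eqP <-; rewrite phi1.
  by rewrite -surjective_pairing.
- by apply/allP => x; rewrite mem_orbit_fc.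
exact: cycle_orbit (@phi_inj _ _ emb) _.
Qed.

Let nextE x y : (x \in c) && (y == next c x) = ((x, y) \in fc d0).
Proof.
apply/andP/idP => [[xc /eqP->]|h]; first exact: (next_cycle contour_cycle xc).
have xc : x \in c by apply/mem_c; exists y.
split=> //; have := next_cycle contour_cycle xc => /= h'.
by have [->] := simple0 h h' erefl.
Qed.

Let edge_ofE x y : edge_of c x y = ((x, y) \in fc d0) || ((y, x) \in fc d0).
Proof. by rewrite /edge_of !nextE. Qed.

Let a d := outside emb c d.

Let a_phi d : dart d -> a (phi d) = a d.
Proof.
have fwd x y : dart x -> fconnect phi x y -> a y -> a x.
  move=> dx /iter_findex <- /existsP[o /andP[oo co]].
  apply/existsP; exists o; rewrite oo; apply: connect_trans co.
  elim: (findex _ _ _) => [|n IH] /=; first exact: connect0.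
  apply: connect_trans IH (connect1 _); apply/orP; left.
  by rewrite face_stepE // dart_iter_phi.
move=> dd; apply/idP/idP; first exact: fwd (fconnect1 _ _).
by apply: fwd; rewrite ?dart_phi // (fconnect_sym (@phi_inj _ _ emb)) fconnect1.
Qed.

Let a_eps d : ~~ edge_of c d.1 d.2 -> a (eps d) = a d.
Proof.
have fwd x : ~~ edge_of c x.1 x.2 -> a (eps x) -> a x.
  move=> nx /existsP[o /andP[oo co]]; apply/existsP; exists o; rewrite oo.
  by apply: connect_trans (connect1 _) co; apply/orP; right; rewrite nx eqxx.
move=> nd; apply/idP/idP; first exact: fwd.
by rewrite -{1}[d]epsK; apply: fwd; rewrite /edge_of orbC.
Qed.

Let a_inner d : d \in fc d0 -> ~~ a d.
Proof.
move=> hd; apply/negP => /existsP[o /andP[oo /connectP[p]]].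
have step x y : x \in fc d0 -> same_side (Defs.rot emb) c x y -> y \in fc d0.
  move=> hx /orP[/eqP->|]; first by rewrite face_stepE ?fcD // fcPhi.
  by case/andP => _; rewrite edge_ofE -surjective_pairing hx.
elim: p d hd => [|y p IH] d hd /=; last by case/andP => /(step _ _ hd) hy; apply: IH.
move=> _ E; case/eqP: inner; rewrite (fc_outer e_sym oo) E.
by apply/esym/eqP; rewrite -mem_fc.
Qed.

Let a_outer d : d \in outer emb -> a d.
Proof. by move=> h; apply/existsP; exists d; rewrite h connect0. Qed.

(* The darts at a node carry as much of [a] as their opposites, and apart from
   the two edges of the contour at that node each dart balances its opposite. *)
Let a_turn p : p \in fc d0 -> a (eps (phi p)) = a (eps p).
Proof.
move=> hp; set d := phi p; have hd : d \in fc d0 by rewrite fcPhi.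
pose P x := dart x && (x.1 == d.1).
have S : \sum_(x | P x) (a (eps x) : nat) = \sum_(x | P x) (a x : nat).
  rewrite [RHS](reindex_inj (@nu_inj _ _ emb)) /=.
  apply: eq_big => [x|x /andP[dx _]]; first by rewrite /P dart_nu nu1.
  by rewrite -phi_eps a_phi // dart_eps.
have Pd : P d by rewrite /P eqxx fcD.
have Pp : P (eps p) by rewrite /P dart_eps // fcD //= /d phi1 eqxx.
have np : eps p != d.
  by rewrite eq_sym; apply: nu_neq; rewrite // dart_eps // fcD.
have Pp' : P (eps p) && (eps p != d) by rewrite Pp np.
move: S; rewrite !(bigD1 d Pd) !(bigD1 (eps p) Pp') /= epsK.
rewrite (negPf (a_inner hd)) (negPf (a_inner hp)) !add0n.
rewrite (eq_bigr (fun x => a x : nat)); last first.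
  move=> x /andP[/andP[/andP[dx /eqP E] nxd] nxp]; rewrite a_eps // edge_ofE negb_or.
  rewrite -surjective_pairing; apply/andP; split.
    by apply: contraNN nxd => hx; apply/eqP; apply: simple0.
  apply: contraNN nxp => hx; apply/eqP; apply: (@nu_inj _ _ emb).
  apply: simple0 hd _; last by rewrite !nu1 E /= /d phi1.
  by rewrite -phi_eps fcPhi.
move/addIn; by case: (a _) => /=; case: (a _).
Qed.

(** Replaces the Jordan curve theorem. By [a_turn] the far sides of the contour edges all agree.
    Were they not outside, nothing would be. So they are outside, and from a non-outside dart off
    the face the face could never be reached, against connectedness. *)
Let a_all d : dart d -> d \notin fc d0 -> a d.
Proof.
have const x : x \in fc d0 -> a (eps x) = a (eps d0).
  move=> /fc_iterP[n _ ->]; elim: n => //= n <-; apply: a_turn.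
  by rewrite mem_fc fc_iter.
have hd0 : d0 \in fc d0 by apply: fc_refl.
case E: (a (eps d0)) => dd nd; last first.
  have clos x : dart x -> ~~ a x -> ~~ a (eps x).
    move=> dx nx; case: (boolP (edge_of c x.1 x.2)) => [|h]; last by rewrite a_eps.
    rewrite edge_ofE -surjective_pairing => /orP[] h; first by rewrite const ?E.
    by apply: a_inner.
  have [o oo Eo] := outerP emb e_sym.
  have : ~~ a o.
    apply: (@dart_ind _ _ e_sym e_4conn emb (fun x => ~~ a x) _ clos d0) => //.
      by move=> x dx nx; rewrite -phi_eps a_phi ?dart_eps // clos.
    exact: a_inner.
  by rewrite a_outer // Eo fc_refl.
apply: contraT => na.
have clos x : dart x -> ~~ a x && (x \notin fc d0) -> ~~ a (eps x) && (eps x \notin fc d0).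
  move=> dx /andP[nx hx]; have [] := boolP (edge_of c x.1 x.2); rewrite edge_ofE.
    rewrite -surjective_pairing (negPf hx) /= => h.
    by have := const _ h; rewrite E -[(x.2, x.1)]/(eps x) epsK (negPf nx).
  rewrite negb_or => /andP[h1 h2]; rewrite a_eps ?nx ?edge_ofE ?negb_or ?h1 //.
have := @dart_ind _ _ e_sym e_4conn emb (fun x => ~~ a x && (x \notin fc d0)) _ clos d d0.
rewrite na nd hd0 andbF; apply=> // x dx /(clos _ dx).
by rewrite -phi_eps a_phi ?dart_eps // fcPhi.
Qed.

(** One dart would be a loop, and two would make [nu] fix a dart, against the minimum degree. *)
Let contour_size : 2 < size c.
Proof.
rewrite size_map size_orbit.
have := iter_order (@phi_inj _ _ emb) d0; have := order_gt0 phi d0.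
case: (order _ _) => [|[|[|n]]] //= _ E; exfalso.
  by have := phi1 emb d0; rewrite E => E1; move: dd0; rewrite /dart -E1 e_irr.
have : nu (eps d0) != eps d0 by apply: nu_neq; rewrite // dart_eps.
case/eqP; apply: dart_ext; rewrite ?nu1 //=.
by rewrite -(phi1 emb) -[nu _]/(phi d0) E.
Qed.

(** By [a_all] only the darts of the face itself are not outside, which leaves no room for a
    surrounded node or a chord. *)
Lemma inner_face_polygon : polygon emb c.
Proof.
apply/and3P; split.
- rewrite /circular_path contour_size contour_uniq /=.
  by apply: sub_cycle contour_cycle => x y /= /fcD.
- apply/forallP => v; apply/negP => /andP[vc /forallP h].
  have [y vy] := dart_at e_irr e_4conn e_deg v.
  have /negP := implyP (h y) vy; apply; apply: a_all => //.
  by apply: contraNN vc => hv; apply/mem_c; exists y.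
apply/forallP => x; apply/forallP => y; apply/negP => /and5P[_ _ xy].
rewrite edge_ofE negb_or => /andP[h _] /negP; apply; exact: a_all.
Qed.

Lemma inner_face_size : #|fc d0| <= max_polygon_edges emb.
Proof.
rewrite -size_contour.
have h : size c < #|V|.+1 by rewrite ltnS; have /card_uniqP <- := contour_uniq; apply: max_card.
have := @leq_bigmax_cond _ (fun n : 'I_#|V|.+1 => [exists c : n.-tuple V, polygon emb c])
  (fun n => n : nat) (Ordinal h); apply => /=.
by apply/existsP; exists (in_tuple c); apply: inner_face_polygon.
Qed.

End InnerFace.
End FaceSize.

(** * Linking the polygons of correct nodes *)

Section Walks.
Variables (V : finType) (e : rel V).

Lemma walkP k x y :
  reflect (exists p, [/\ path e x p, last x p = y & size p = k]) (walk e k x y).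
Proof.
apply: (iffP existsP) => [[p /andP[h /eqP l]]|[p [h l /eqP s]]].
  by exists p; rewrite size_tuple.
by exists (Tuple s); rewrite /= h l eqxx.
Qed.

Lemma walk0 x : walk e 0 x x.
Proof. by apply/walkP; exists [::]. Qed.

Lemma walk1 x y : e x y -> walk e 1 x y.
Proof. by move=> h; apply/walkP; exists [:: y]; rewrite /= h. Qed.

Lemma walk_cat k l x y z : walk e k x y -> walk e l y z -> walk e (k + l) x z.
Proof.
move=> /walkP[p [hp Ep <-]] /walkP[q [hq Eq <-]].
by apply/walkP; exists (p ++ q); rewrite cat_path hp Ep hq last_cat Ep Eq size_cat.
Qed.

Lemma walk_sym k x y : symmetric e -> walk e k x y -> walk e k y x.
Proof.
move=> e_sym; elim: k x => [|k IH] x /walkP[[|a p] [//= h E s]].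
  by rewrite -E; apply: walk0.
move: h s => /andP[xa h] [s]; rewrite -addn1.
apply: walk_cat (IH a _) _; first by apply/walkP; exists p.
by apply: walk1; rewrite e_sym.
Qed.

Lemma bigmin_leq (I : Type) (r : seq I) (P : pred I) (F : I -> nat) n :
  (forall j, has (fun i => P i && (F i == j)) r -> \big[minn/n]_(i <- r | P i) F i <= j).
Proof.
move=> j; elim: r => //= i r IH; rewrite big_cons.
case: ifP => //= hP /orP[/eqP <-|/IH h]; first exact: geq_minl.
exact: leq_trans (geq_minr _ _) h.
Qed.

Lemma bigmin_attained (I : Type) (r : seq I) (P : pred I) (F : I -> nat) n :
  (\big[minn/n]_(i <- r | P i) F i = n) \/
  (exists i, P i /\ \big[minn/n]_(i <- r | P i) F i = F i).
Proof.
elim/big_rec: _ => [|i m hP IH]; first by left.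
rewrite /minn; case: ifP => _ //; by right; exists i.
Qed.

Lemma bigmin_default (I : Type) (r : seq I) (P : pred I) (F : I -> nat) n :
  \big[minn/n]_(i <- r | P i) F i <= n.
Proof. by elim/big_rec: _ => // i m _ h; apply: leq_trans (geq_minr _ _) h. Qed.

Lemma distance_leq k x y : walk e k x y -> distance e x y <= k.
Proof.
move=> w; case: (ltnP k #|V|) => h; last exact: leq_trans (bigmin_default _ _ _ _) h.
rewrite /distance; apply: bigmin_leq; apply/hasP; exists (Ordinal h) => //=.
  by rewrite mem_index_enum.
by rewrite w eqxx.
Qed.

Lemma walk_diameter x y : connect e x y ->
  exists2 k, k <= diameter e & walk e k x y.
Proof.
case/connectP => p hp ->; case: (shortenP hp) => q hq uq _.
have sq : size q < #|V| by have /card_uniqP /= <- := uq; apply: max_card.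
have w : walk e (size q) x (last x q) by apply/walkP; exists q.
have le : distance e x (last x q) <= diameter e.
  apply: leq_trans (leq_bigmax (F := fun x => \max_y distance e x y) x).
  exact: (leq_bigmax (F := fun y => distance e x y)).
exists (distance e x (last x q)) => //.
have := distance_leq w; rewrite /distance.
(* The default [#|V|] is excluded because the shortened path [q] has fewer edges, so an actual walk
   attains the minimum. *)
have [->|[i [hi ->]] _ //] := bigmin_attained (index_enum 'I_#|V|)
  (fun k : 'I_#|V| => walk e k x (last x q)) (fun k => k : nat) #|V|.
by rewrite leqNgt sq.
Qed.

End Walks.

Section Linking.
Variables (V : finType) (e : rel V) (emb : plane_embedding e).
Hypotheses (e_sym : symmetric e) (e_irr : irreflexive e).
Hypotheses (e_4conn : four_connected e) (e_deg : 4 <= max_degree e).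
Local Notation nu := (nu emb).
Local Notation phi := (phi emb).
Local Notation dart := (dart e).
Local Notation fc := (fc emb).
Local Notation inc := (inc emb).
Local Notation simple := (@face_simple _ _ emb e_sym e_irr e_4conn e_deg).
Local Notation nuD := (nu_neq e_irr e_4conn e_deg emb).
Local Notation nuDi := (iter_nu_neq e_irr e_4conn e_deg emb).
Local Notation nuI := (@nu_inj _ _ emb).

Variables (Z : nat) (B : {set V}).
Hypothesis Zmax : max_polygon_edges emb <= Z.
Hypothesis B_far :
  forall b1 b2, b1 \in B -> b2 \in B -> b1 != b2 -> Z < distance e b1 b2.

Lemma inc_dart v d : dart d -> inc v d -> exists2 d', dart d' & d'.1 = v /\ fc d' = fc d.
Proof.
move=> dd /incP[d' E1 E2]; exists d' => //.
by rewrite (@dart_fc _ _ emb e_sym d d') // mem_fc E2.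
Qed.

Lemma walk_iter_phi d i : dart d -> walk e i d.1 (iter i phi d).1.
Proof.
move=> dd; elim: i => [|i IH]; first exact: walk0.
rewrite -addn1; apply: walk_cat IH (walk1 _); rewrite addn1 /= phi1.
by have := dart_iter_phi emb e_sym i d; rewrite dd.
Qed.

(** The shorter way round the contour; the factor one half lets two faces fit within [Z] in
    [byz_unique]. *)
Lemma face_walk x y d : dart d -> inc x d -> inc y d ->
  exists2 k, k.*2 <= #|fc d| & walk e k x y.
Proof.
move=> dd /(inc_dart dd)[dx ddx [<- Fx]] /incP[dy <- Fy].
have /fc_iterP[i] : dy \in fc dx by rewrite mem_fc Fy Fx.
rewrite -Fx => hi ->; case: (leqP i.*2 #|fc dx|) => h.
  by exists i => //; apply: walk_iter_phi.
exists (#|fc dx| - i); first by rewrite doubleB leq_subLR -addnn leq_add2r ltnW.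
apply: walk_sym => //; have := @walk_iter_phi (iter i phi dx) (#|fc dx| - i).
rewrite dart_iter_phi // -iterD subnK; last exact: ltnW.
have -> : #|fc dx| = order phi dx by rewrite /order cardsE.
by rewrite iter_order; [apply | apply: phi_inj].
Qed.

Lemma byz_unique b b' d d' : b \in B -> b' \in B -> dart d -> dart d' -> d.1 = d'.1 ->
  fc d != outer emb -> fc d' != outer emb -> inc b d -> inc b' d' -> b = b'.
Proof.
move=> hb hb' dd dd' E o o' i i'; apply/eqP; apply: contraT => /(B_far hb hb').
have [k hk wk] := face_walk dd i (inc1 emb d).
have := inc1 emb d'; rewrite -E => i1; have [l hl wl] := face_walk dd' i1 i'.
have := inner_face_size e_sym e_irr e_4conn e_deg dd o.
have := inner_face_size e_sym e_irr e_4conn e_deg dd' o'.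
have := distance_leq (walk_cat wk wl); lia.
Qed.

Definition good (d : V * V) : bool :=
  [&& dart d, fc d != outer emb & [forall b in B, ~~ inc b d]].

(** The outer face is left out: its length is not bounded by [Z], so its nodes may be far from
    [b]. *)
Definition star (b : V) : {set V} :=
  [set x | (x != b) && [exists d, [&& dart d, d.1 == x, fc d != outer emb & inc b d]]].

Lemma starP b x : reflect (x != b /\ exists d, [/\ dart d, d.1 = x, fc d != outer emb & inc b d])
  (x \in star b).
Proof.
rewrite inE; apply: (iffP andP) => -[nx].
  by move=> /existsP[d /and4P[h1 /eqP h2 h3 h4]]; split=> //; exists d.
by case=> d [h1 /eqP h2 h3 h4]; split=> //; apply/existsP; exists d; apply/and4P.
Qed.

Lemma good_dart d : good d -> dart d.
Proof. by case/and3P. Qed.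

Lemma good_fc d d' : dart d -> dart d' -> fc d = fc d' -> good d = good d'.
Proof.
move=> dd dd' E; rewrite /good dd dd' E; congr [&& _, _ & _]; apply: eq_forallb => b.
by rewrite (inc_fc _ E).
Qed.

Lemma good_phi d : good (phi d) = good d.
Proof.
case dd : (dart d); first by rewrite (@good_fc (phi d) d) ?fc_phi ?dart_phi.
by rewrite /good dart_phi // dd.
Qed.

Lemma good_inc d b : b \in B -> inc b d -> ~~ good d.
Proof.
by move=> hb i; apply/negP => /and3P[_ _ /forallP/(_ b)]; rewrite hb i.
Qed.

Lemma badP d : dart d -> ~~ good d ->
  fc d = outer emb \/ exists b, [/\ b \in B, fc d != outer emb & inc b d].
Proof.
move=> dd; rewrite /good dd /=; case: (eqVneq (fc d) (outer emb)) => [->|n]; first by left.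
rewrite /= => /forallPn[b]; rewrite negb_imply negbK => /andP[hb i]; right.
by exists b.
Qed.

Lemma star_bad b x d : b \in B -> x \in star b -> dart d -> d.1 = x -> ~~ good d ->
  fc d = outer emb \/ inc b d.
Proof.
move=> hb /starP[nx [d1 [dd1 E1 o1 i1]]] dd E /(badP dd)[|[b' [hb' o i]]]; first by left.
by right; rewrite (@byz_unique b b' d1 d) // E1 E.
Qed.

Lemma star_faces b d d' : dart d -> dart d' -> d.1 = d'.1 -> d.1 != b ->
  inc b d -> inc b d' -> d != d' ->
  (d = (d.1, b) /\ d' = nu d) \/ (d' = (d.1, b) /\ d = nu d').
Proof.
move=> dd dd' E nb i i' nd.
have [g dg [Eg Fg]] := inc_dart dd i; have [g' dg' [Eg' Fg']] := inc_dart dd' i'.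
have := @two_faces _ _ emb e_sym e_irr e_4conn e_deg d d' g' g dd dd' dg' dg E.
rewrite Eg Eg' Fg Fg'; apply=> //.
by apply: contraNneq nd => /(simple dd dd' E) ->.
Qed.

(** By [star_faces] the faces at a node that contain [b] are at most the two sides of the edge to
    [b], so they form a single run for [nu]. *)
Lemma star_exit b d d' : dart d -> dart d' -> d.1 = d'.1 -> d.1 != b ->
  inc b d -> inc b d' -> ~~ inc b (nu d) -> ~~ inc b (nu d') -> d = d'.
Proof.
move=> dd dd' E nb i i' n n'; apply/eqP; apply: contraT => /(star_faces dd dd' E nb i i').
by case=> -[_ F]; [rewrite -F i' in n|rewrite -F i in n'].
Qed.

Lemma turn_change (Q : pred (V * V)) d d' : dart d -> dart d' -> d.1 = d'.1 ->
  Q d != Q d' -> exists f, [/\ dart f, f.1 = d.1, Q f = Q d & Q (nu f) != Q d].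
Proof.
move=> dd dd' E; have /iter_findex <- := nu_connect emb dd dd' E.
elim: (findex _ _ _) => [|n IH] /=; first by rewrite eqxx.
have [h h'|h _] := eqVneq (Q (iter n nu d)) (Q d); last by apply: IH; rewrite eq_sym.
by exists (iter n nu d); rewrite dart_iter_nu iter_nu1 eq_sym; split.
Qed.

Lemma turn_exit (bad Q : pred (V * V)) d d' : dart d -> dart d' -> d.1 = d'.1 ->
  (forall f, dart f -> f.1 = d.1 -> ~~ bad f -> ~~ bad (nu f) -> Q f = Q (nu f)) ->
  ~~ bad d -> ~~ bad d' -> Q d != Q d' ->
  exists f, [/\ dart f, f.1 = d.1, bad f, ~~ bad (nu f) & Q (nu f) != Q d].
Proof.
move=> dd dd' E clos nd nd' nQ.
have [] := @turn_change (fun f => bad f || (Q f == Q d)) d d' dd dd' E.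
  by rewrite (negPf nd) (negPf nd') eqxx /= [Q d' == _]eq_sym (negPf nQ).
move=> f [df Ef]; rewrite eqxx orbT => h; rewrite eqb_id negb_or => /andP[nb nq].
exists f; split=> //; case/orP: h => // /eqP h; apply: contraT => nf.
by rewrite -clos // h eqxx in nq.
Qed.

(** Cutting one interval out of a cyclic order leaves it connected. Turning from [d] to [d'] and on
    to [d] again, both changes of [Q] would occur at the exit of the only bad run, with opposite
    values. *)
Lemma one_exit (bad Q : pred (V * V)) d d' : dart d -> dart d' -> d.1 = d'.1 ->
  (forall f, dart f -> f.1 = d.1 -> ~~ bad f -> ~~ bad (nu f) -> Q f = Q (nu f)) ->
  (forall f f', dart f -> dart f' -> f.1 = d.1 -> f'.1 = d.1 -> bad f -> bad f' ->
    ~~ bad (nu f) -> ~~ bad (nu f') -> f = f') ->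
  ~~ bad d -> ~~ bad d' -> Q d = Q d'.
Proof.
move=> dd dd' E clos uniq nd nd'; apply/eqP; apply: contraT => nQ.
have [f [df Ef bf nf Qf]] := turn_exit dd dd' E clos nd nd' nQ.
have [||f' [df' Ef' bf' nf' Qf']] := @turn_exit bad Q d' d dd' dd (esym E) _ nd' nd.
  by rewrite -E.
  by rewrite eq_sym.
have Ef'' : f' = f by apply: uniq; rewrite // Ef' E.
by move: nQ Qf Qf'; rewrite Ef''; case: (Q _); case: (Q _); case: (Q _).
Qed.

(** [three_faces] for the curve through [x], [b] and [y] that closes up in the outer face: two
    contacts of a star with that face are joined by an edge having [b] on its inner side. *)
Lemma contact b x y o o' : x \in star b -> y \in star b -> x != y ->
  dart o -> dart o' -> o.1 = x -> o'.1 = y -> fc o = outer emb -> fc o' = outer emb ->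
  ~~ inc b o ->
  (o = (x, y) /\ inc b (nu (x, y))) \/ (o = nu (x, y) /\ inc b (x, y)).
Proof.
move=> /starP[nx [dx [ddx Ex ox ix]]] /starP[ny [dy [ddy Ey oy iy]]] nxy do_ do' Eo Eo' Fo Fo' nb.
have [g dg [Eg Fg]] := inc_dart ddx ix; have [g' dg' [Eg' Fg']] := inc_dart ddy iy.
have := @three_faces _ _ emb e_sym e_irr e_4conn e_deg o dx dy o' g g'.
rewrite Eg Eg' Fg Fg' Ex Ey Eo Eo' Fo Fo'.
by case=> //.
Qed.

(** * Unions of good faces closed under crossing edges *)

Section LinkedSet.
Variable X : pred (V * V).
Hypothesis X_good : forall d, X d -> good d.
Hypothesis X_phi : forall d, X (phi d) = X d.

(** The darts [d] and [nu d] lie on the two sides of the edge [d]: membership passes across each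
    edge at [x]. *)
Definition closed_at (x : V) : Prop :=
  forall d, d.1 = x -> good d -> good (nu d) -> X d = X (nu d).

Definition const_at (x : V) : Prop :=
  forall d d', good d -> good d' -> d.1 = x -> d'.1 = x -> X d = X d'.

Lemma X_nu d : X (nu d) = X (eps d).
Proof. by rewrite -phi_eps X_phi. Qed.

Lemma X_bad d : ~~ good d -> X d = false.
Proof. by move=> h; apply: contraNF h; apply: X_good. Qed.

(** * Around one Byzantine node *)

Section Star.
Variable b : V.
Hypotheses (bB : b \in B) (star_closed : forall x, x \in star b -> closed_at x).

(* [inc b] gains as many linked neighbours as it loses: an edge between a face
   around [b] and a linked face is met once from each end.  At every node the
   linked darts are left as often as entered, so the outer face balances too. *)
Lemma outer_flow : (forall o, dart o -> fc o = outer emb -> ~~ inc b o) ->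
  \sum_(d | dart d && (d.1 \in star b)) (fc d == outer emb) * X (nu d) =
  \sum_(d | dart d && (d.1 \in star b)) X d * (fc (nu d) == outer emb).
Proof.
move=> bo; pose P d := dart d && (d.1 \in star b).
have EX : \sum_(d | P d) X d = \sum_(d | P d) X (nu d).
  rewrite (reindex_inj nuI); apply: eq_bigl => d.
  by rewrite /P dart_nu nu1.
have incb d : dart d -> d.1 = b -> X (nu d) = false.
  by move=> dd E; apply: X_bad; apply: (good_inc bB); rewrite -E -(nu1 emb); apply: inc1.
have full F : (forall d, dart d -> d.1 \notin star b -> F d = 0) ->
    \sum_(d | P d) F d = \sum_(d | dart d) F d.
  move=> h; rewrite [RHS](bigID (fun d => d.1 \in star b)) /=.
  by rewrite [X in _ + X]big1 ?addn0 // => d /andP[]; apply: h.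
have out d : dart d -> inc b d -> d.1 \notin star b -> d.1 = b.
  move=> dd i; apply: contraNeq => nb; apply/starP; split=> //; exists d; split=> //.
  by apply: contraL i => /eqP; apply: bo.
have ES : \sum_(d | P d) inc b d * X (nu d) = \sum_(d | P d) X d * inc b (nu d).
  rewrite !full.
  - rewrite (reindex_inj (@eps_inj V)) /=; apply: eq_big => [d|d _]; first exact: dart_eps.
    by rewrite mulnC X_nu epsK (inc_fc b (fc_nu emb d)).
  - move=> d dd nd; case i : (inc b (nu d)); rewrite ?muln0 // muln1.
    by rewrite X_bad // (good_inc bB) // -(out (nu d)) ?dart_nu // nu1 // inc1.
  move=> d dd nd; case i : (inc b d); rewrite ?mul0n // mul1n.
  by rewrite incb //; apply: out.
have key : \sum_(d | P d) (inc b d * X (nu d) + (fc d == outer emb) * X (nu d) + X d) =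
           \sum_(d | P d) (X d * inc b (nu d) + X d * (fc (nu d) == outer emb) + X (nu d)).
  apply: eq_bigr => d /andP[dd ds].
  have gE f : dart f -> f.1 = d.1 -> good f = ~~ (inc b f || (fc f == outer emb)).
    move=> df Ef; apply/idP/idP => h.
      rewrite negb_or; case/and3P: (h) => _ -> _; rewrite andbT.
      by apply: contraL h; apply: good_inc.
    apply: contraNT h => h; case: (star_bad bB ds df Ef h) => ->; rewrite ?eqxx ?orbT //.
  have ex f : dart f -> inc b f && (fc f == outer emb) = false.
    move=> df; apply/negP => /andP[i /eqP o].
    by case/negP: (bo f df o).
  have dn : dart (nu d) by rewrite dart_nu.
  have := star_closed ds (erefl d.1); rewrite (gE d) // (gE (nu d)) ?nu1 //.
  have := @X_bad d; have := @X_bad (nu d); rewrite (gE d) // (gE (nu d)) ?nu1 //.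
  have := ex d dd; have := ex _ dn.
  case: (inc b d); case: (inc b (nu d)); case: (fc d == _); case: (fc (nu d) == _);
   case: (X d); case: (X (nu d)) => //= h1 h2 h3 h4 h5;
   by [have := h3 isT | have := h4 isT | have := h5 isT isT].
by move: key; rewrite !big_split /= ES EX => /addIn /addnI.
Qed.

Lemma outer_dart_unique o o' : dart o -> dart o' -> o.1 = o'.1 ->
  fc o = outer emb -> fc o' = outer emb -> o = o'.
Proof. by move=> d d' E F F'; apply: simple; rewrite ?F ?F'. Qed.

(** [outer_flow] for one or two contacts: each sum keeps one term per contact, [p1] and [p2] being
    the darts just before [o1] and [o2]. *)
Lemma outer_flow2 o1 o2 : dart o1 -> dart o2 -> fc o1 = outer emb -> fc o2 = outer emb ->
  o1.1 \in star b -> o2.1 \in star b -> ~~ inc b o1 ->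
  (forall d, dart d -> fc d = outer emb -> d.1 \in star b -> d = o1 \/ d = o2) ->
  forall p1 p2, nu p1 = o1 -> nu p2 = o2 ->
  if o1 == o2 then X (nu o1) = X p1
  else X (nu o1) + X (nu o2) = X p1 + X p2.
Proof.
move=> do1 do2 F1 F2 s1 s2 nb only p1 p2 Ep1 Ep2.
have dp1 : dart p1 by rewrite -(dart_nu emb) Ep1.
have dp2 : dart p2 by rewrite -(dart_nu emb) Ep2.
have bo o : dart o -> fc o = outer emb -> ~~ inc b o.
  by move=> _ F; rewrite (@inc_fc _ _ emb b o o1) // F1.
have := outer_flow bo.
rewrite (bigD1 o1) ?do1 ?s1 //= F1 eqxx mul1n.
rewrite [X in _ = X](bigD1 p1) /=; last by rewrite dp1 -(nu1 emb) Ep1 s1.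
rewrite Ep1 F1 eqxx muln1.
have [Eo|No] := eqVneq o1 o2.
  rewrite !big1 ?addn0.
  - by case: (X _); case: (X _).
  - move=> d /andP[/andP[dd ds] nd]; case: eqP => [F|]; rewrite ?muln0 //.
    case/eqP: nd; apply: nuI; rewrite Ep1.
    by case: (only (nu d)); rewrite ?dart_nu ?nu1 // Eo.
  move=> d /andP[/andP[dd ds] nd]; case: eqP => [F|]; rewrite ?mul0n //.
  by case/eqP: nd; case: (only d); rewrite // Eo.
rewrite (bigD1 o2) ?do2 ?s2 1?eq_sym ?No //= F2 eqxx mul1n.
rewrite [X in _ = _ + X](bigD1 p2) /=; last first.
  rewrite dp2 -(nu1 emb) Ep2 s2 /=; apply: contraNneq No => E.
  by rewrite -Ep1 -Ep2 E.
rewrite Ep2 F2 eqxx muln1 !big1 ?addn0 //.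
- move=> d /andP[/andP[/andP[dd ds] nd] nd']; case: eqP => [F|]; rewrite ?muln0 //.
  case: (only (nu d)); rewrite ?dart_nu ?nu1 // => E.
    by case/eqP: nd; apply: nuI; rewrite Ep1.
  by case/eqP: nd'; apply: nuI; rewrite Ep2.
move=> d /andP[/andP[/andP[dd ds] nd] nd']; case: eqP => [F|]; rewrite ?mul0n //.
by case: (only d) => // E; [case/eqP: nd|case/eqP: nd'].
Qed.

(** The faces at [x] through [b] form one run, so only the outer face could cut the good ones in
    two. Either it belongs to that run or, by [contact] with another star node, adjoins it; or [x]
    is the only contact, and the flow equation makes both sides of the outer corner agree. *)
Lemma star_const x : x \in star b -> const_at x.
Proof.
move=> hx; have /starP[nxb [dx [ddx Ex ox ix]]] := hx.
have clos := star_closed hx.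
have plain : (forall d, dart d -> d.1 = x -> ~~ good d -> inc b d) -> const_at x.
  move=> bad_inc d d' gd gd' Ed Ed'.
  apply: (@one_exit (inc b)); rewrite ?(good_dart gd) ?(good_dart gd') ?Ed ?Ed' //.
  - move=> f df Ef n n'; apply: clos => //.
      by apply: contraNT n; apply: bad_inc.
    by apply: contraNT n'; apply: bad_inc; rewrite ?dart_nu ?nu1.
  - move=> f f' df df' Ef Ef' i i' n n'; apply: (@star_exit b) => //; first by rewrite Ef.
    by rewrite Ef.
  - by apply: contraL gd; apply: good_inc.
  by apply: contraL gd'; apply: good_inc.
case: (boolP [exists o, [&& dart o, o.1 == x & fc o == outer emb]]); last first.
  move=> /existsPn no; apply: plain => d dd Ed /(star_bad bB hx dd Ed)[F|//].
  by have := no d; rewrite dd Ed F !eqxx.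
case/existsP => o /and3P[do_ /eqP Eo /eqP Fo].
have uo d : dart d -> d.1 = x -> fc d = outer emb -> d = o.
  by move=> dd Ed Fd; apply: outer_dart_unique; rewrite // Eo.
case: (boolP (inc b o)) => io.
  apply: plain => d dd Ed /(star_bad bB hx dd Ed)[F|//].
  by rewrite (uo d).
have bad d : dart d -> d.1 = x -> ~~ good d -> d = o \/ inc b d.
  by move=> dd Ed /(star_bad bB hx dd Ed)[F|]; [left; apply: uo|right].
have ngood d : good d -> ~~ inc b d by apply: contraL; apply: good_inc.
have [p [Ep dp p1]] := nu_pred emb o; rewrite do_ in dp; rewrite Eo in p1.
case: (boolP [exists o', [&& dart o', o'.1 != x, o'.1 \in star b & fc o' == outer emb]]).
  case/existsP => o' /and4P[do' nx' s' /eqP Fo'].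
  have Hc : inc b (nu o) \/ inc b p.
    have nxx : x != o'.1 by rewrite eq_sym.
    have [[-> //]|[Eo' ip]] := contact hx s' nxx do_ do' Eo erefl Fo Fo' io; first by left.
    by right; rewrite (nuI (etrans Ep Eo')).
  move=> d d' gd gd' Ed Ed'.
  apply: (@one_exit (fun d => ~~ good d));
    rewrite ?(good_dart gd) ?(good_dart gd') ?Ed ?Ed' ?negbK //.
    by move=> f df Ef; rewrite !negbK; apply: clos.
  (* If [o] is an exit, the run of [b] must end at [p], just before it, and has no exit of its
     own. *)
  have key f f' : dart f -> dart f' -> f.1 = x -> f'.1 = x -> ~~ good f -> ~~ good f' ->
     good (nu f) -> good (nu f') -> f = o -> f' = o.
    move=> df df' Ef Ef' nf nf' gf gf' Eof.
    case: (bad f' df' Ef' nf') => // i'; exfalso.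
    case: Hc => [i|i]; first by case/negP: (ngood _ gf); rewrite Eof.
    have [E|n] := eqVneq f' p.
      by move: gf'; rewrite E Ep -Eof (negPf nf).
    have := @star_faces b f' p df' dp; rewrite Ef' p1 => /(_ erefl nxb i' i n).
    case=> -[_ E]; first by case/negP: (ngood _ gf'); rewrite -E.
    by case/negP: io; rewrite -Ep -E.
  move=> f f' df df' Ef Ef' nf nf'; rewrite !negbK => gf gf'.
  case: (bad f df Ef nf) => [E|i].
    by rewrite E; apply/esym; apply: (key f).
  case: (bad f' df' Ef' nf') => [E|i'].
    by rewrite E; apply: (key f').
  by apply: (@star_exit b) => //; rewrite ?Ef ?Ef' //; apply: ngood.
move=> /existsPn only.
have Xo : X (nu o) = X p.
  have := @outer_flow2 o o do_ do_ Fo Fo; rewrite Eo => /(_ hx hx io _ p p Ep Ep).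
  rewrite eqxx; apply=> d dd Fd sd; left; apply: uo => //.
  by have := only d; rewrite dd sd Fd eqxx !andbT /= negbK => /eqP.
move=> d d' gd gd' Ed Ed'.
have no f : good f -> f != o.
  by move=> gf; apply: contraTneq gf => ->; rewrite /good Fo eqxx andbF.
(* Giving the outer corner the common value of its two sides removes this obstacle; only the run of
   [b] remains. *)
pose Q f := if f == o then X (nu o) else X f.
have QE f : good f -> Q f = X f by move/no/negPf; rewrite /Q => ->.
rewrite -(QE d) // -(QE d') //.
apply: (@one_exit (inc b)); rewrite ?(good_dart gd) ?(good_dart gd') ?Ed ?Ed' ?ngood //.
  move=> f df Ef n n'; rewrite /Q; have [E|nf] := eqVneq f o.
    by rewrite E (negPf (nuD do_)).
  have [E|nf'] := eqVneq (nu f) o.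
    by rewrite Xo; congr (X _); apply: nuI; rewrite E Ep.
  apply: clos => //; [apply: contraNT n|apply: contraNT n'] => h.
    by case: (bad f df Ef h) => // E; rewrite E eqxx in nf.
  by case: (bad (nu f) _ _ h); rewrite ?dart_nu ?nu1 // => E; rewrite E eqxx in nf'.
move=> f f' df df' Ef Ef' i i' n n'; apply: (@star_exit b) => //; by rewrite Ef.
Qed.

Definition status (x : V) : bool := [exists d, [&& good d, d.1 == x & X d]].

Lemma statusE x d : const_at x -> good d -> d.1 = x -> status x = X d.
Proof.
move=> cx gd Ed; apply/existsP/idP => [[d' /and3P[gd' /eqP Ed' h]]|h].
  by rewrite (cx d d').
by exists d; rewrite gd Ed eqxx.
Qed.

Lemma good_edge_status x y : const_at x -> const_at y -> good (x, y) -> status x = status y.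
Proof.
move=> cx cy g; by rewrite (statusE cx g) // (@statusE y (phi (x, y))) ?good_phi ?phi1 // X_phi.
Qed.

(** If the other side of the edge is good, both ends lie on it. Otherwise it is the outer face, and
    [x] and [y] are the only contacts; in the flow equation the two terms on the face of [b] vanish,
    which equates a good face at [x] with one at [y]. *)
Lemma ring_edge x y : dart (x, y) -> fc (x, y) != outer emb -> inc b (x, y) ->
  x != b -> y != b -> status x = status y.
Proof.
move=> dxy oxy ixy nx ny.
have dyx : dart (y, x) by rewrite -[(y, x)]/(eps (x, y)) dart_eps.
have dnu : dart (nu (x, y)) by rewrite dart_nu.
have Fnu : fc (nu (x, y)) = fc (y, x) by rewrite fc_nu.
have Fnu' : fc (nu (y, x)) = fc (x, y) by rewrite fc_nu.
have sx : x \in star b by apply/starP; split=> //; exists (x, y).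
have sy : y \in star b.
  by apply/starP; split=> //; exists (nu (y, x)); rewrite dart_nu nu1 Fnu' (inc_fc b Fnu').
have cx := star_const sx; have cy := star_const sy.
have nxb : (x, y) != (x, b) by apply: contraNneq ny => -[->].
have sep d : dart d -> d.1 = x -> inc b d -> d != (x, y) -> (x, y) = nu d.
  move=> dd Ed i n.
  case: (@star_faces b d (x, y) dd dxy); rewrite ?Ed // => -[E]; first by [].
  by rewrite E eqxx in nxb.
have iyx : ~~ inc b (y, x).
  rewrite -(inc_fc b Fnu); apply/negP => i.
  have := sep _ dnu (nu1 emb _) i (nuD dxy).
  by move/eqP; rewrite eq_sym (negPf (nuDi (i := 2) dxy isT)).
case: (boolP (good (y, x))) => [g|n].
  by rewrite (good_edge_status cy cx).
have Fo : fc (y, x) = outer emb.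
  by case: (star_bad bB sy dyx erefl n) => // i; rewrite i in iyx.
set ox := nu (x, y); have Fox : fc ox = outer emb by rewrite Fnu.
have iox : ~~ inc b ox by rewrite (inc_fc b Fnu).
have [p [Ep dp p1]] := nu_pred emb (y, x); rewrite dyx in dp.
(* Were [nu ox] on a face of [b], [sep] would close a [nu]-cycle of length three, against the
   minimum degree. *)
have gx : good (nu ox).
  apply: contraT => h; have dnn : dart (nu ox) by rewrite dart_nu.
  have Enn : (nu ox).1 = x by rewrite !nu1.
  case: (star_bad bB sx dnn Enn h) => [F|i].
    have /eqP := outer_dart_unique dnn dnu (nu1 emb _) F Fox.
    by rewrite (negPf (nuD dnu)).
  have /eqP := sep _ dnn Enn i (nuDi (i := 2) dxy isT).
  by rewrite eq_sym (negPf (nuDi (i := 3) dxy isT)).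
have gp : good p.
  apply: contraT => h.
  case: (star_bad bB sy dp p1 h) => [F|i].
    have /eqP := outer_dart_unique dp dyx p1 F Fo.
    by rewrite -Ep eq_sym (negPf (nuD dp)).
  have dq : dart (nu (y, x)) by rewrite dart_nu.
  have iq : inc b (nu (y, x)) by rewrite (inc_fc b Fnu').
  have npq : p != nu (y, x) by rewrite -Ep eq_sym; apply: (nuDi (i := 2) dp).
  have := @star_faces b p _ dp dq; rewrite p1 nu1 => /(_ erefl ny i iq npq).
  case=> -[_ /eqP E]; first by rewrite Ep (negPf (nuD dyx)) in E.
  by rewrite -Ep eq_sym (negPf (nuDi (i := 3) dp isT)) in E.
have nxy : x != y by apply: contraTneq dxy => ->; rewrite /dart /= e_irr.
have only d : dart d -> fc d = outer emb -> d.1 \in star b -> d = ox \/ d = (y, x).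
  move=> dd Fd sd; have [E|ndx] := eqVneq d.1 x.
    by left; apply: outer_dart_unique; rewrite // nu1.
  have [E|ndy] := eqVneq d.1 y; first by right; apply: outer_dart_unique.
  have nxd : x != d.1 by rewrite eq_sym.
  case: (contact sx sd nxd dnu dd (nu1 emb _) erefl Fox Fd iox) => -[E i].
    by rewrite -E in i; have := good_inc bB i; rewrite gx.
  by have := nuI E => -[Ey]; rewrite Ey eqxx in ndy.
have := outer_flow2 dnu dyx Fox Fo; rewrite nu1 => /(_ sx sy iox only (x, y) p erefl Ep).
have -> : (nu (x, y) == (y, x)) = false.
  by apply: contraNF nxy => /eqP E; rewrite -[x]/(x, y).1 -(nu1 emb) E.
rewrite (X_bad (good_inc bB ixy)) (@X_bad (nu (y, x))); last first.
  by apply: (good_inc bB); rewrite (inc_fc b Fnu').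
rewrite addn0 add0n => E; rewrite (statusE cx gx) ?nu1 //.
by rewrite (statusE cy gp) //; move: E; case: (X _); case: (X _).
Qed.

(** The contour between two consecutive neighbours of [b] does not meet [b] again, by [face_simple],
    so [ring_edge] applies to each of its edges. *)
Lemma face_turn n' : e b n' -> fc (nu (b, n')) != outer emb ->
  status (nu (b, n')).2 = status n'.
Proof.
move=> bn'; set d := nu (b, n') => Fd; set n := d.2.
have db : dart (b, n') by [].
have dd : dart d by rewrite dart_nu.
have d1 : d.1 = b by rewrite nu1.
have fd i : fc (iter i phi d) = fc d by rewrite fc_iter.
have di i : dart (iter i phi d) by rewrite dart_iter_phi.
have run i : 0 < i -> (forall j, 0 < j <= i -> (iter j phi d).1 != b) ->
    status (iter i phi d).1 = status n.
  elim: i => // -[|i] IH _ h; first by rewrite /= phi1.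
  rewrite -IH // => [|j /andP[j0 ji]]; last by apply: h; rewrite j0 ltnW.
  apply/esym; have n1 := h i.+1; have n2 := h i.+2.
  rewrite [iter i.+2 _ _]/= phi1; move: n1 n2; rewrite [iter i.+2 _ _]/= phi1 !ltnS leqnn leqnSn.
  move=> /(_ isT) n1 /(_ isT) n2; apply: ring_edge => //; rewrite -surjective_pairing ?fd //.
  by rewrite (inc_fc b (fd i.+1)) -d1 inc1.
have : (n', b) \in fc d by rewrite mem_fc fc_nu.
rewrite inE => c; have := findex_max c; have := iter_findex c.
move: (findex _ _ _) => m Em hm.
rewrite -[n']/(n', b).1 -Em run // => [|j /andP[j0 jm]].
  case: m Em {hm} => // E; have E1 : (n', b).1 = d.1 by rewrite -E.
  by move: bn'; rewrite -[n']/(n', b).1 E1 d1 e_irr.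
apply/eqP => E; have E2 : iter j phi d = d by apply: simple; rewrite // E d1.
by have := findex_iter (leq_ltn_trans jm hm); rewrite E2 findex0 => E0; rewrite -E0 in j0.
Qed.

(** Turning around [b], the status changes only across the outer face, which has at most one corner
    at [b]; a cyclic sequence cannot change exactly once. *)
Lemma byz_neighbours n n' : e b n -> e b n' -> status n = status n'.
Proof.
move=> bn bn'; have [//|nE] := eqVneq (status n) (status n'); exfalso.
have turn m m' : e b m -> e b m' -> status m != status m' ->
   exists f, [/\ dart f, f.1 = b, status f.2 = status m & fc (nu f) = outer emb].
  move=> bm bm' h.
  have [|f [df f1 Q1 Q2]] := @turn_change (fun d => status d.2) (b, m) (b, m') bm bm' erefl.
    exact: h.
  exists f; split=> //; apply/eqP; apply: contraNT Q2 => o.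
  case: f df f1 Q1 o => x y df /= Ex Q1 o; subst x.
  by rewrite face_turn // Q1.
have [f [df f1 Q F]] := turn n n' bn bn' nE.
have [|f' [df' f1' Q' F']] := turn n' n bn' bn; first by rewrite eq_sym.
have E : f = f'.
  by apply: nuI; apply: outer_dart_unique; rewrite ?dart_nu ?nu1 // f1 f1'.
by rewrite -Q -Q' E eqxx in nE.
Qed.

End Star.

Definition locally_closed (v : V) : Prop :=
  closed_at v /\ forall b, b \in B -> v \in star b -> forall x, x \in star b -> closed_at x.

(** Off all stars the only bad corner at [v] is that of the outer face, and one corner does not
    disconnect the rest. *)
Lemma vertex_const v : v \notin B -> locally_closed v -> const_at v.
Proof.
move=> vB [cv cs]; case: (boolP [exists b in B, v \in star b]) => [/existsP[b /andP[hb sv]]|].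
  exact: (star_const hb (cs b hb sv)).
move=> /existsPn ns d d' gd gd' Ed Ed'.
have bad f : dart f -> f.1 = v -> ~~ good f -> fc f = outer emb.
  move=> df Ef /(badP df)[//|[b [hb o i]]]; exfalso.
  have /nandP[/negP//|/negP] := ns b; apply; apply/starP; split; last by exists f.
  by apply: contraNneq vB => ->.
apply: (@one_exit (fun d => ~~ good d));
    rewrite ?(good_dart gd) ?(good_dart gd') ?Ed ?Ed' ?negbK //.
  by move=> f df Ef; rewrite !negbK; apply: cv.
move=> f f' df df' Ef Ef' nf nf' _ _; apply: simple; rewrite ?Ef ?Ef' //.
by rewrite !bad.
Qed.

(** The sides of an edge cannot both be outer, by [face_simple]; a side neither good nor outer
    contains a Byzantine node, so [ring_edge] applies. *)
Lemma edge_status v v' : v \notin B -> v' \notin B -> e v v' ->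
  locally_closed v -> locally_closed v' -> status v = status v'.
Proof.
move=> vB vB' vv' lv lv'.
have cv := vertex_const vB lv; have cv' := vertex_const vB' lv'.
have v'v : e v' v by rewrite e_sym.
have [g|n] := boolP (good (v, v')); first exact: good_edge_status cv cv' g.
have [g|n'] := boolP (good (v', v)); first by rewrite -(good_edge_status cv' cv).
have ring x y : x \notin B -> y \notin B -> e x y -> locally_closed x ->
    fc (x, y) != outer emb -> ~~ good (x, y) -> status x = status y.
  move=> xB yB xy lx o h; case: (badP (xy : dart (x, y)) h) => [F|[b [hb _ i]]].
    by rewrite F eqxx in o.
  have nx : x != b by apply: contraNneq xB => ->.
  have ny : y != b by apply: contraNneq yB => ->.
  apply: (ring_edge hb (lx.2 b hb _)) => //.
  by apply/starP; split=> //; exists (x, y).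
have [F|o] := eqVneq (fc (v, v')) (outer emb); last exact: ring.
have [F'|o'] := eqVneq (fc (v', v)) (outer emb); last by rewrite -(ring v' v).
have /eqP : nu (v, v') = (v, v').
  by apply: outer_dart_unique; rewrite ?dart_nu ?nu1 // fc_nu.
by rewrite (negPf (nuD (vv' : dart (v, v')))).
Qed.

End LinkedSet.

(** With [o] the outer corner, if any, neither [nu o] nor [iter 3 nu o] is outer. Were both bad,
    they would contain the same Byzantine node and hence be consecutive, which degree four
    forbids. *)
Lemma good_at v : v \notin B -> exists2 d, good d & d.1 = v.
Proof.
move=> vB.
have [o [do_ Eo ho]] : exists o, [/\ dart o, o.1 = v &
    forall d, dart d -> d.1 = v -> fc d = outer emb -> d = o].
  have [y vy] := dart_at e_irr e_4conn e_deg v.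
  case: (boolP [exists o, [&& dart o, o.1 == v & fc o == outer emb]]).
    case/existsP => o /and3P[do_ /eqP Eo /eqP Fo]; exists o; split=> // d dd Ed Fd.
    by apply: simple; rewrite ?Ed ?Fd.
  move/existsPn => no; exists (v, y); split=> // d dd Ed Fd.
  by have := no d; rewrite dd Ed Fd !eqxx.
set d1 := nu o; set d3 := iter 3 nu o.
have dd1 : dart d1 by rewrite dart_nu.
have dd3 : dart d3 by rewrite dart_iter_nu.
have E1 : d1.1 = v by rewrite nu1.
have E3 : d3.1 = v by rewrite iter_nu1.
have [g|n1] := boolP (good d1); first by exists d1.
have [g|n3] := boolP (good d3); first by exists d3.
exfalso.
case: (badP dd1 n1) => [/(ho _ dd1 E1)/eqP|[b [hb o1 i1]]].
  by rewrite (negPf (nuD do_)).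
case: (badP dd3 n3) => [/(ho _ dd3 E3)/eqP|[b' [hb' o3 i3]]].
  by rewrite (negPf (nuDi (i := 3) do_ isT)).
have E : b' = b by apply: (@byz_unique b' b d3 d1); rewrite // E1 E3.
rewrite E in i3; have nvb : d1.1 != b by rewrite E1; apply: contraNneq vB => ->.
have n13 : d1 != d3 by rewrite eq_sym; apply: (nuDi (i := 2) dd1).
have [[_ /eqP]|[_ /eqP]] := star_faces dd1 dd3 (etrans E1 (esym E3)) nvb i1 i3 n13.
  by rewrite [d3]/= -/d1 (inj_eq nuI) (negPf (nuD dd1)).
by rewrite [d3]/= -/d1 eq_sym (negPf (nuDi (i := 3) dd1 isT)).
Qed.

End Linking.

(** * Safety and progress of the protocol *)

Section Occurs.
Variables (A : Type).

Fixpoint occurs (a : A) (l : seq A) : Prop :=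
  if l is b :: l' then b = a \/ occurs a l' else False.

Lemma occurs_cat a l l' : occurs a (l ++ l') <-> occurs a l \/ occurs a l'.
Proof. by elim: l => [|b l IH] /=; tauto. Qed.

Lemma occurs_rcons a l : occurs a (rcons l a).
Proof. by rewrite -cats1; apply/occurs_cat; right; left. Qed.

End Occurs.

Lemma occurs_from (Q : eqType) (K : Type) q (k : K) (l : seq (Q * K)) :
  occurs k [seq y.2 | y <- l & y.1 == q] <-> occurs (q, k) l.
Proof.
elim: l => //= -[q' k'] l IH /=; case: eqP => [->|n] /=; rewrite IH.
  by split=> -[]; [move=> ->; left|right|case=> ->; left|right].
by split; [right|case=> // -[]].
Qed.

Section Protocol.
Variables (V : finType) (M : Type) (e : rel V) (s : V) (Z : nat) (B : {set V}) (m0 : M).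
Hypotheses (e_sym : symmetric e) (e_irr : irreflexive e) (sB : s \notin B) (Z3 : 3 <= Z).
Hypothesis B_far :
  forall b1 b2, b1 \in B -> b2 \in B -> b1 != b2 -> Z < distance e b1 b2.

Local Notation receive := (@Defs.receive V M e s Z).
Local Notation receive_all := (@Defs.receive_all V M e s Z).

(* A forged message names a Byzantine node among the nodes it claims to come
   from, and that node is no farther than the length of the claimed route. *)
Definition sound (q : V) (m : M) (S : {set V}) : Prop :=
  m = m0 \/ exists b k, [/\ b \in B, b \in q |: S, k <= #|S| & walk e k b q].

Definition sound_packet (q : V) (k : packet V M) : Prop :=
  match k with
  | Raw m => q = s -> m = m0
  | Tagged m R => sound q m R
  end.

Definition sound_state (p : V) (st : state V M) : Prop :=
  match st with
  | Active rec =>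
      (forall q m S, rec q = Some (m, S) ->
         [/\ e q p, q \notin S, #|S| <= Z - 3 & sound q m S]) /\
      (forall m, ~ deliverable rec m)
  | Delivered m => m = m0
  end.

Lemma sound_byz q k : q \in B -> sound_packet q k.
Proof.
move=> qB; case: k => [m E|m S] /=; first by case/negP: sB; rewrite -E.
by right; exists q, 0; rewrite !inE eqxx walk0.
Qed.

Lemma sound_forward p q m (S : {set V}) : e q p -> q \notin S -> sound q m S -> sound p m (q |: S).
Proof.
move=> qp qS [->|[b [k [bB bS kS w]]]]; first by left.
right; exists b, k.+1; split=> //; first by rewrite !inE in bS *; rewrite bS orbT.
  by rewrite cardsU1 qS add1n.
by rewrite -addn1; apply: walk_cat w (walk1 _).
Qed.

(** If both records were forged, [q] would be Byzantine, its record naming nobody else. The other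
    record would give a Byzantine node within [Z - 3] of [p'], so within [Z - 1] of [q], and
    distinct from [q], which it does not name. *)
Lemma sound_deliver p (rec : V -> option (M * {set V})) m : (forall q m S, rec q = Some (m, S) ->
    [/\ e q p, q \notin S, #|S| <= Z - 3 & sound q m S]) ->
  deliverable rec m -> m = m0.
Proof.
move=> h [p' [q [S [nq qS rq rp']]]].
have [qp _ _ [//|[b [k [bB]]]]] := h _ _ _ rq.
rewrite setU0 inE => /eqP Eb _ _; subst b.
have [p'p _ cS [//|[b [l [b'B bS lS w]]]]] := h _ _ _ rp'.
have nb : b != q.
  by apply/eqP => E; move: bS; rewrite E !inE (negPf nq) (negPf qS).
have pq : e p q by rewrite e_sym.
have := distance_leq (walk_cat (walk_cat w (walk1 p'p)) (walk1 pq)).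
rewrite leqNgt -addnA => /negP[]; apply: leq_ltn_trans (B_far b'B bB nb).
by rewrite -[leqRHS](subnK Z3) leq_add // (leq_trans lS).
Qed.

Lemma set_rec_same rec q r : @set_rec V M rec q r q = Some r.
Proof. by rewrite /set_rec eqxx. Qed.

Lemma set_rec_other rec q r q' : q' != q -> @set_rec V M rec q r q' = rec q'.
Proof. by rewrite /set_rec => /negPf ->. Qed.

Lemma receive_sound p st q k st' o : receive p st q k st' o ->
  e q p -> sound_packet q k -> sound_state p st ->
  sound_state p st' /\ forall k', occurs k' o -> sound_packet p k'.
Proof.
have upd rec q1 m (S : {set V}) : e q1 p -> q1 \notin S -> #|S| <= Z - 3 -> sound q1 m S ->
    sound_state p (Active rec) -> forall q' m' S', set_rec rec q1 (m, S) q' = Some (m', S') ->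
    [/\ e q' p, q' \notin S', #|S'| <= Z - 3 & sound q' m' S'].
  move=> qp qS cS sd [h _] q' m' S'; have [->|n] := eqVneq q' q1.
    by rewrite set_rec_same => -[<- <-].
  by rewrite set_rec_other //; apply: h.
have d0 m : m = m0 -> sound_packet p (Tagged m set0) by left.
case: st q k st' o / => //=.
- by move=> rec m _ _ /(_ erefl) -> _; split=> // k' [<-|//]; apply: d0.
- move=> rec q' m S _ qS cS nd qp sd h; split.
    by split=> //; apply: upd.
  by move=> k' [<-|//]; apply: sound_forward.
- move=> rec q' m S m' _ qS cS dl qp sd h.
  have Em : m' = m0 by apply: sound_deliver dl; apply: upd.
  split=> // k' [<-|[<-|//]]; first exact: sound_forward.
  exact: d0.
Qed.

(** * Reading a whole inbox *)

Lemma receive_all_cons p st q k inbox st' o : receive_all p st ((q, k) :: inbox) st' o ->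
  exists st1 o1 o2, [/\ receive p st q k st1 o1, receive_all p st1 inbox st' o2 & o = o1 ++ o2].
Proof. by move=> H; inversion H; subst; exists st1, out1, out2. Qed.

Lemma receive_all_nil p st st' o : receive_all p st [::] st' o -> st' = st /\ o = [::].
Proof. by move=> H; inversion H. Qed.

Lemma receive_all_sound p inbox st st' o : receive_all p st inbox st' o ->
  (forall q k, occurs (q, k) inbox -> e q p /\ sound_packet q k) -> sound_state p st ->
  sound_state p st' /\ forall k', occurs k' o -> sound_packet p k'.
Proof.
elim: inbox st o => [|[q k] inbox IH] st o.
  by move=> /receive_all_nil[-> ->] _ h.
case/receive_all_cons => st1 [o1 [o2 [r1 r2 ->]]] hin hst.
have [e1 k1] := hin q k (or_introl erefl).
have [h1 hk1] := receive_sound r1 e1 k1 hst.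
have [|h2 hk2] := IH _ _ r2 _ h1; first by move=> q' k' h; apply: hin; right.
by split=> // k' /occurs_cat[/hk1|/hk2].
Qed.

Lemma receive_all_delivered p m inbox st' o :
  receive_all p (Delivered m) inbox st' o -> st' = Delivered m /\ o = [::].
Proof.
elim: inbox st' o => [|[q k] inbox IH] st' o; first exact: receive_all_nil.
case/receive_all_cons => st1 [o1 [o2 [r1 r2 ->]]].
by inversion r1; subst; case: (IH _ _ r2) => -> ->.
Qed.

Lemma receive_last p rec q k m o : receive p (Active rec) q k (Delivered m) o ->
  exists l, o = rcons l (Tagged m set0).
Proof.
move=> H; inversion H; subst; first by exists [::].
by exists [:: Tagged m1 (q |: S)].
Qed.

Lemma receive_all_last p inbox rec m o : receive_all p (Active rec) inbox (Delivered m) o ->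
  exists l, o = rcons l (Tagged m set0).
Proof.
elim: inbox rec o => [|[q k] inbox IH] rec o; first by case/receive_all_nil.
case/receive_all_cons => [[rec1|m1]] [o1 [o2 [r1 r2 ->]]].
  by have [l ->] := IH _ _ r2; exists (o1 ++ l); rewrite rcons_cat.
have [[Em] ->] := receive_all_delivered r2; have [l ->] := receive_last r1.
by exists l; rewrite Em cats0.
Qed.

Lemma receive_all_source p inbox st st' o m : e s p -> receive_all p st inbox st' o ->
  occurs (s, Raw m) inbox -> exists m', st' = Delivered m'.
Proof.
move=> sp; elim: inbox st o => [//|[q k] inbox IH] st o.
case/receive_all_cons => st1 [o1 [o2 [r1 r2 _]]] [[Eq Ek]|]; last exact: IH r2.
subst q k; suff [m' E] : exists m', st1 = Delivered m'.
  by rewrite E in r2; have [-> _] := receive_all_delivered r2; exists m'.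
inversion r1; subst; try by [eexists].
- by exfalso; match goal with H : ~ (_ /\ _) |- _ => apply: H end; split=> //; exists m.
- by match goal with H : is_true (~~ e s p) |- _ => rewrite sp in H end.
Qed.

Lemma receive_plain p rec q k st' o : ~~ e s p -> receive p (Active rec) q k st' o ->
  [\/ exists m', st' = Delivered m',
      st' = Active rec /\ (forall m S, k = Tagged m S -> ~~ ((q \notin S) && (#|S| <= Z - 3)))
    | exists m S, [/\ k = Tagged m S, q \notin S /\ #|S| <= Z - 3,
        st' = Active (set_rec rec q (m, S)), o = [:: Tagged m (q |: S)]
      & forall m', ~ deliverable (set_rec rec q (m, S)) m']].
Proof.
move=> /negPf sp H; inversion H; subst;
  try by match goal with h : is_true (e _ p) |- _ => rewrite sp in h end.
- by constructor 3; exists m, S.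
- by constructor 1; exists m'.
- by constructor 2; split=> // m' S' [_ <-].
- by constructor 2; split.
Qed.

Lemma receive_all_active p inbox st rec' o : receive_all p st inbox (Active rec') o ->
  exists rec, st = Active rec.
Proof.
case: st => [rec|m]; first by exists rec.
by case/receive_all_delivered.
Qed.

Lemma receive_all_none p inbox rec rec' o q : ~~ e s p ->
  receive_all p (Active rec) inbox (Active rec') o ->
  [seq y.2 | y <- inbox & y.1 == q] = [::] -> rec' q = rec q.
Proof.
move=> sp; elim: inbox rec o => [|[q' k] inbox IH] rec o.
  by case/receive_all_nil => -[->].
case/receive_all_cons => st1 [o1 [o2 [r1 r2 _]]] /=.
case: (eqVneq q' q) => //= n h; have [rec1 E] := receive_all_active r2; subst st1.
rewrite (IH _ _ r2) //; case: (receive_plain sp r1) => [[]//|[[->]]//|].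
by case=> m [S [_ _ [->] _ _]]; rewrite set_rec_other // eq_sym.
Qed.

Lemma receive_all_rec p inbox rec rec' o q m l : ~~ e s p ->
  receive_all p (Active rec) inbox (Active rec') o ->
  [seq y.2 | y <- inbox & y.1 == q] = rcons l (Tagged m set0) -> rec' q = Some (m, set0).
Proof.
move=> sp; elim: inbox rec o l => [|[q' k] inbox IH] rec o l; first by case: l.
case/receive_all_cons => st1 [o1 [o2 [r1 r2 _]]] /=.
have [rec1 E] := receive_all_active r2; subst st1.
case: (eqVneq q' q) => [Eq|n] /=; [subst q'|exact: (IH _ _ _ r2)].
case: l => [|k' l] [Ek h]; last exact: (IH _ _ _ r2 h).
rewrite (receive_all_none sp r2 h); case: (receive_plain sp r1) => [[]//|[_ /(_ _ _ Ek)]|].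
  by rewrite inE cards0.
case=> m' [S [Ek' _ [->] _ _]]; rewrite Ek in Ek'.
by case: Ek' => -> ->; rewrite set_rec_same.
Qed.

Lemma receive_all_forward p inbox rec rec' o q m (S : {set V}) : ~~ e s p ->
  receive_all p (Active rec) inbox (Active rec') o ->
  occurs (q, Tagged m S) inbox -> q \notin S -> #|S| <= Z - 3 -> occurs (Tagged m (q |: S)) o.
Proof.
move=> sp; elim: inbox rec o => [//|[q' k] inbox IH] rec o.
case/receive_all_cons => st1 [o1 [o2 [r1 r2 ->]]] hin qS cS; apply/occurs_cat.
have [rec1 E] := receive_all_active r2; subst st1.
case: hin => [[Eq Ek]|h]; last by right; apply: (IH _ _ r2).
left; subst q' k; case: (receive_plain sp r1) => [[]//|[_ /(_ _ _ erefl)]|].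
  by rewrite qS cS.
by case=> m' [S' [[<- <-] _ _ -> _]]; left.
Qed.

(** Only a packet from [q] can overwrite [rec q], so [(m, set0)] is still there when [(m, S)]
    arrives and the delivery rule fires. *)
Lemma receive_all_collide p inbox rec rec' o q q' m (S : {set V}) : ~~ e s p ->
  receive_all p (Active rec) inbox (Active rec') o ->
  rec q = Some (m, set0) -> [seq y.2 | y <- inbox & y.1 == q] = [::] ->
  occurs (q', Tagged m S) inbox -> q' \notin S -> #|S| <= Z - 3 -> q != q' -> q \notin S ->
  False.
Proof.
move=> sp; elim: inbox rec o => [//|[q1 k] inbox IH] rec o.
case/receive_all_cons => st1 [o1 [o2 [r1 r2 _]]] rq /=.
have [rec1 E] := receive_all_active r2; subst st1.
case: (eqVneq q1 q) => //= n h hin qS cS nq nS.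
case: (receive_plain sp r1) => [[]//|[[E1] R1]|[m1 [S1 [Ek [qS1 cS1] [E1] _ nd]]]].
  case: hin => [[Eq Ek]|hin]; last by apply: (IH _ _ r2); rewrite ?E1.
  by move: (R1 m S Ek); rewrite Eq qS cS.
case: hin => [[Eq Ek']|hin]; last first.
  by apply: (IH _ _ r2); rewrite // E1 set_rec_other // eq_sym.
apply: (nd m); exists q', q, S; split=> //.
  by rewrite set_rec_other // Eq.
by rewrite Ek in Ek'; case: Ek' => -> ->; rewrite Eq set_rec_same.
Qed.

(** * Executions: safety and timing *)

Section Execution.
Variables (R : realFieldType) (i0 : nat) (x : trace R V M) (T : R).
Hypotheses (x_exec : execution e s Z B m0 i0 x) (x_delay : activation_delay_le T x).
Local Notation st i p := (node_state (conf x i) p).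
Local Notation ch i q p := (chan (conf x i) q p).

Lemma initial_state p : st 0 p = Active (fun=> None).
Proof. by case: x_exec => -[[h _] _]. Qed.

Lemma date_mono i j : i <= j -> (date x i <= date x j)%R.
Proof. by case: x_exec => _ _ h _ _; apply: h. Qed.

Lemma date_ge0 i : (0 <= date x i)%R.
Proof. by case: x_exec => _ h _ _ _; apply: le_trans h (date_mono (leq0n i)). Qed.

Lemma step i : activation e s Z B m0 (i == i0) (actor x i) (conf x i) (conf x i.+1).
Proof. by case: x_exec. Qed.

(** An earlier activation of [p] bounds the gap; if there is none, the bound on its first activation
    does, as dates are nonnegative. *)
Lemma next_activation p i : exists j, [/\ i < j, actor x j = p,
  forall k, i < k < j -> actor x k <> p & (date x j <= date x i + T)%R].
Proof.
have ex : exists j, (i < j) && (actor x j == p).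
  have [_ _ _ fair _] := x_exec; have [j ij /eqP Ej] := fair p i.+1.
  by exists j; rewrite ij.
case: (ex_minnP ex) => j /andP[ij /eqP Ej] minj; exists j.
have gap k : i < k < j -> actor x k <> p.
  move=> /andP[ik kj] /eqP E; have := minj k; rewrite ik E => /(_ isT).
  by rewrite leqNgt kj.
split=> //; case: (boolP [exists k : 'I_i.+1, actor x k == p]) => [/existsP[k0 hk0]|no].
  have exk : exists k, (k <= i) && (actor x k == p).
    by exists k0; rewrite hk0 andbT -ltnS ltn_ord.
  have ub k : (k <= i) && (actor x k == p) -> k <= i by case/andP.
  case: (ex_maxnP exk ub) => k /andP[ki /eqP Ek] maxk.
  have := x_delay.1 p k j (leq_ltn_trans ki ij) Ek Ej.
  have := date_mono ki; move=> h1 h2; suff : (date x j - date x k <= T)%R by lra.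
  apply: h2 => l /andP[kl lj] /eqP El; case: (ltnP i l) => il.
    by apply: (gap l); [rewrite il | apply/eqP].
  by have := maxk l; rewrite il El => /(_ isT); rewrite leqNgt kl.
have := x_delay.2 p j Ej; have := date_ge0 i => h1 h2.
suff : (date x j <= T)%R by lra.
apply: h2 => k kj /eqP Ek; case: (ltnP i k) => ik.
  by apply: (gap k); [rewrite ik | apply/eqP].
by move/existsPn/(_ (inord k)): no; rewrite inordK // Ek.
Qed.

Lemma delay_ge0 : (0 <= T)%R.
Proof.
have [j [_ _ _ h]] := next_activation s 0; have := date_mono (leq0n j); lra.
Qed.

Lemma chan_edge i q r : ~~ e q r -> ch i q r = [::].
Proof.
move=> n; elim: i => [|i IH]; first by case: x_exec => -[[_ h] _].
have [inbox [out [_ -> _ _]]] := step i; rewrite IH if_same /=.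
by case: eqP => //= <-; rewrite (negPf n).
Qed.

(** Whatever a Byzantine node sends is sound by [sound_byz], so only correct activations need
    checking. *)
Lemma execution_sound i :
  (forall q p k, occurs k (ch i q p) -> sound_packet q k) /\
  (forall p, p \notin B -> sound_state p (st i p)).
Proof.
elim: i => [|i [IHc IHs]].
  split=> [q p k|p _]; first by have [[[_ ->] _] _ _ _ _] := x_exec.
  by rewrite initial_state /=; split=> // m [p' [q [S []]]].
have [inbox [out [hin hch hst hB]]] := step i; set a := actor x i in hin hch hst hB.
have hinbox q k : occurs (q, k) inbox -> e q a /\ sound_packet q k.
  move=> h; have h' : occurs k (ch i q a) by rewrite -hin; apply/occurs_from.
  split; last exact: IHc h'.
  by apply: contraT => n; rewrite chan_edge in h'.
have [hout hsta] : (forall r k, occurs k (out r) -> sound_packet a k) /\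
    (a \notin B -> sound_state a (st i.+1 a)).
  have [aB|aB] := boolP (a \in B); first by split=> // *; apply: sound_byz.
  have [o [ho]] := hB aB; have [as_|_] := eqVneq a s.
    have [_ [Es Eo]|_ [Es Eo]] := eqVneq i i0.
      by rewrite as_ Es; split=> // r k; rewrite ho Eo => -[<-|//].
    by rewrite as_ Es -as_; split=> [r k|_]; rewrite ?ho ?Eo //; apply: IHs.
  move=> /receive_all_sound /(_ hinbox (IHs a aB)) [h1 h2].
  by split=> // r k; rewrite ho; apply: h2.
split=> [q r k|p pB]; last first.
  have [E|n] := eqVneq p a; first by move: pB; rewrite E; apply: hsta.
  by rewrite hst //; apply: IHs.
rewrite hch => /occurs_cat[|]; first by case: ifP => // _; apply: IHc.
by case: ifP => // /andP[/eqP -> _]; apply: hout.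
Qed.

Definition delivered (i : nat) (p : V) : Prop := st i p = Delivered m0.

Lemma active_or_delivered i p : p \notin B -> (exists rec, st i p = Active rec) \/ delivered i p.
Proof.
rewrite /delivered => /(execution_sound i).2; case: (st i p) => [rec|m] /= h.
  by left; exists rec.
by right; rewrite h.
Qed.

Lemma correct_step i p : actor x i = p -> p \notin B -> p != s ->
  exists inbox o, [/\ forall q, [seq y.2 | y <- inbox & y.1 == q] = ch i q p,
    receive_all p (st i p) inbox (st i.+1 p) o
  & forall q r, ch i.+1 q r = (if r == p then [::] else ch i q r) ++
      (if (q == p) && e p r then o else [::])].
Proof.
move=> Ea pB ps; have [inbox [out [hin hch _ hB]]] := step i; rewrite Ea in hin hch hB.
have [o [ho]] := hB pB; rewrite (negPf ps) => ro; exists inbox, o; split=> // q r.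
by rewrite hch ho.
Qed.

Lemma state_idle i p : actor x i <> p -> st i.+1 p = st i p.
Proof. by move=> /eqP n; have [inbox [out [_ _ h _]]] := step i; apply: h; rewrite eq_sym. Qed.

Lemma delivered_succ i p : p \notin B -> delivered i p -> delivered i.+1 p.
Proof.
rewrite /delivered => pB d; have [Ea|n] := eqVneq (actor x i) p; last first.
  by rewrite state_idle //; apply/eqP.
have [E|ps] := eqVneq p s; last first.
  have [inbox [o [_ + _]]] := correct_step Ea pB ps.
  by rewrite d => /receive_all_delivered[].
have [inbox [out [_ _ _ hB]]] := step i; rewrite Ea E eqxx in hB.
have [o [_]] := hB sB; case: ifP => _ [h _]; first by rewrite E h.
by rewrite E h -E.
Qed.

Lemma delivered_mono i j p : p \notin B -> i <= j -> delivered i p -> delivered j p.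
Proof.
move=> pB ij d; rewrite -(subnK ij) addnC; elim: (j - i) => [|n IH]; first by rewrite addn0.
by rewrite addnS; apply: delivered_succ.
Qed.

Lemma active_mono i j p rec : p \notin B -> i <= j -> st j p = Active rec ->
  exists rec', st i p = Active rec'.
Proof.
move=> pB ij Ej; case: (active_or_delivered i pB) => // /(delivered_mono pB ij).
by rewrite /delivered Ej.
Qed.

Definition delivered_by (p : V) (t : R) : Prop :=
  exists2 i, (date x i <= t)%R & delivered i.+1 p.

Lemma delivered_by_le p t t' : (t <= t')%R -> delivered_by p t -> delivered_by p t'.
Proof. by move=> h [i hi d]; exists i => //; apply: le_trans hi h. Qed.

Lemma delivered_byE p t : p \notin B -> delivered_by p t -> delivers_by x p m0 t.
Proof.
move=> pB [i hi d]; exists i => // j ij; exact: delivered_mono d.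
Qed.

Lemma source_delivered : delivered_by s (date x i0).
Proof.
exists i0 => //; have [inbox [out [_ _ _ hB]]] := step i0.
have Es : actor x i0 = s by case: x_exec => -[].
rewrite Es !eqxx in hB; by have [o [_ [h _]]] := hB sB.
Qed.

Lemma chan_idle i q r : actor x i <> r -> exists l, ch i.+1 q r = ch i q r ++ l.
Proof.
move=> /eqP n; have [inbox [out [_ hch _ _]]] := step i; rewrite hch eq_sym (negPf n).
by eexists.
Qed.

Lemma occurs_wait k i j q r : i <= j -> (forall l, i <= l < j -> actor x l <> r) ->
  occurs k (ch i q r) -> occurs k (ch j q r).
Proof.
elim: j => [|j IH] ij idle h; first by move: ij h; case: i {idle} => //.
move: ij; rewrite leq_eqVlt => /orP[/eqP <- //|ij].
have [|l ->] := @chan_idle j q r; first by apply: idle; rewrite leqnn andbT.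
apply/occurs_cat; left; apply: IH => // l' /andP[h1 h2]; apply: idle.
by rewrite h1 ltnW.
Qed.

Lemma source_neighbours p : p \notin B -> e s p -> delivered_by p (date x i0 + T)%R.
Proof.
move=> pB sp; have ps : p != s by apply: contraTneq sp => ->; rewrite e_irr.
have Es : actor x i0 = s by case: x_exec => -[].
have [j [ij Ej gap hj]] := next_activation p i0; exists j => //.
have h0 : occurs (Raw m0) (ch i0.+1 s p).
  have [inbox [out [_ hch _ hB]]] := step i0; rewrite Es !eqxx in hB hch.
  have [o [ho [_ Eo]]] := hB sB; rewrite hch eqxx sp ho Eo.
  by apply/occurs_cat; right; left.
have := occurs_wait ij _ h0; move=> /(_ gap) hr.
have [inbox [o [hin ro _]]] := correct_step Ej pB ps.
rewrite -hin in hr; have [m' E] := receive_all_source sp ro ((occurs_from _ _ _).1 hr).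
case: (active_or_delivered j.+1 pB) => [[rec]|//]; by rewrite E.
Qed.

(** * Messages travelling along an arc *)

Definition sent (r : V) (a : nat) : Prop :=
  [/\ r \notin B, r != s, delivered a.+1 r &
    forall y, e r y -> exists l, ch a.+1 r y = rcons l (Tagged m0 set0)].

Lemma delivered_sent r i : r \notin B -> r != s -> delivered i.+1 r -> exists2 a, a <= i & sent r a.
Proof.
move=> rB rs; elim: i => [|i IH] d.
  exists 0 => //; split=> // y ry; have := d; rewrite /delivered.
  have [Ea|n] := eqVneq (actor x 0) r; last by rewrite state_idle ?initial_state //; apply/eqP.
  have [inbox [o [_ + hch]]] := correct_step Ea rB rs; rewrite initial_state => ro E.
  rewrite E in ro; have [l El] := receive_all_last ro.
  rewrite hch eqxx ry El -rcons_cat; by eexists.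
case: (active_or_delivered i.+1 rB) => [[rec Ei]|/IH[a ai h]]; last by exists a => //; apply: leqW.
exists i.+1 => //; split=> // y ry; have := d; rewrite /delivered.
have [Ea|n] := eqVneq (actor x i.+1) r; last by rewrite state_idle ?Ei //; apply/eqP.
have [inbox [o [_ + hch]]] := correct_step Ea rB rs; rewrite Ei => ro E.
rewrite E in ro; have [l El] := receive_all_last ro.
rewrite hch eqxx ry El -rcons_cat; by eexists.
Qed.

Lemma silent i q r : q \notin B -> q != s -> delivered i q ->
  ch i.+1 q r = if r == actor x i then [::] else ch i q r.
Proof.
move=> qB qs d; have [Ea|n] := eqVneq (actor x i) q.
  have [inbox [o [_ + hch]]] := correct_step Ea qB qs.
  rewrite d hch Ea => /receive_all_delivered[_ ->]; by rewrite if_same cats0.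
have [inbox [out [_ hch _ _]]] := step i; rewrite hch.
by rewrite [q == _]eq_sym (negPf n) cats0.
Qed.

Lemma sent_wait r a j y : sent r a -> a < j -> (forall k, a < k < j -> actor x k <> y) ->
  ch j r y = ch a.+1 r y.
Proof.
case=> rB rs d _; elim: j => // j IH; rewrite ltnS leq_eqVlt => /orP[/eqP <- //|aj] gap.
rewrite silent //; last exact: delivered_mono d.
case: eqP => [E|_]; first by case: (gap j); rewrite ?aj ?leqnn.
by apply: IH => // k /andP[h1 h2]; apply: gap; rewrite h1 ltnW.
Qed.

Definition relay (y : V) : bool := [&& y \notin B, y != s & ~~ e s y].

Definition reads (y q : V) (S : {set V}) (j : nat) : Prop :=
  [/\ actor x j = y, occurs (Tagged m0 S) (ch j q y), q \notin S & #|S| <= Z - 3].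

(** A node stops once it has delivered, so nothing overwrites its record after its last packet has
    been read. *)
Definition settled (y r : V) (j : nat) : Prop :=
  forall k, j < k -> ch k r y = [::] /\
    forall rec, st k y = Active rec -> rec r = Some (m0, set0).

Lemma first_read r a y : sent r a -> e r y -> relay y ->
  exists j, [/\ a < j, (date x j <= date x a + T)%R, reads y r set0 j & settled y r j].
Proof.
move=> sr ry /and3P[yB ys sy]; have [j [aj Ej gap hj]] := next_activation y a.
have [rB rs d hl] := sr; have [l El] := hl y ry.
have Er : ch j r y = rcons l (Tagged m0 set0) by rewrite (sent_wait sr aj gap).
exists j; split=> //.
  by split; rewrite ?Er ?inE ?cards0 //; apply: occurs_rcons.
elim=> // k IH; rewrite ltnS leq_eqVlt => /orP[/eqP Ek|jk].
  subst k; have [inbox [o [hin ro hch]]] := correct_step Ej yB ys; split.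
    by rewrite hch eqxx; case: eqP ry => // ->; rewrite e_irr.
  move=> rec Erec; have [rec0 E0] := active_mono yB (leqnSn j) Erec.
  rewrite E0 Erec in ro; apply: (receive_all_rec sy ro (l := l)); by rewrite hin.
have [c0 hrec] := IH jk.
have c1 : ch k.+1 r y = [::].
  by rewrite silent ?c0 ?if_same //; apply: delivered_mono d => //; apply: ltn_trans jk.
split=> // rec Erec; have [Ek|n] := eqVneq (actor x k) y; last first.
  by apply: hrec; rewrite -Erec state_idle //; apply/eqP.
have [inbox [o [hin ro _]]] := correct_step Ek yB ys.
have [rec0 E0] := active_mono yB (leqnSn k) Erec; rewrite E0 Erec in ro.
by rewrite (receive_all_none sy ro) ?hin ?c0 //; apply: hrec.
Qed.

Lemma collide y q p S i j : relay y -> settled y q i -> i < j -> reads y p S j ->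
  q != p -> q \notin S -> delivered j.+1 y.
Proof.
move=> /and3P[yB ys sy] hq ij [Ej hocc pS cS] qp qS.
case: (active_or_delivered j.+1 yB) => // -[rec' E']; exfalso.
have [rec E] := active_mono yB (leqnSn j) E'.
have [inbox [o [hin ro _]]] := correct_step Ej yB ys; rewrite E E' in ro.
have [c0 hrec] := hq j ij.
apply: (receive_all_collide sy ro (hrec _ E) _ _ pS cS qp qS); first by rewrite hin.
by apply/occurs_from; rewrite hin.
Qed.

Lemma forward y q (S : {set V}) j z : relay y -> reads y q S j -> ~ delivered j.+1 y ->
  e y z -> exists j', [/\ j < j', (date x j' <= date x j + T)%R, actor x j' = z
    & occurs (Tagged m0 (q |: S)) (ch j' y z)].
Proof.
move=> /and3P[yB ys sy] [Ej hocc qS cS] nd yz.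
have [j' [jj' Ej' gap hj']] := next_activation z j; exists j'; split=> //.
apply: (occurs_wait jj') => //.
have [inbox [o [hin ro hch]]] := correct_step Ej yB ys.
case: (active_or_delivered j.+1 yB) => // -[rec' E'].
have [rec E] := active_mono yB (leqnSn j) E'; rewrite E E' in ro.
rewrite hch eqxx yz /=; apply/occurs_cat; right.
by apply: (receive_all_forward sy ro) => //; apply/occurs_from; rewrite hin.
Qed.

(** A node that does not deliver forwards what it reads. The names gathered are old ones or nodes
    already passed, so no node of the path rejects the message while it fits in [Z - 3]. The bound
    [j + size zs <= j'] counts activations, to compare with the wave from the other end. *)
Lemma wave zs y q (S : {set V}) j : reads y q S j -> all relay (y :: zs) -> path e y zs ->
  uniq (y :: zs) -> (forall v, v \in y :: zs -> v \notin q |: S) -> #|S| + size zs <= Z - 3 ->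
  (exists y' j', [/\ y' \in y :: zs, (date x j' <= date x j + (size zs)%:R * T)%R
     & delivered j'.+1 y']) \/
  (exists p' S' j', [/\ (date x j' <= date x j + (size zs)%:R * T)%R, j + size zs <= j',
     reads (last y zs) p' S' j' & forall v, v \in p' |: S' -> v \in q |: S \/ v \in y :: zs]).
Proof.
elim: zs y q S j => [|z zs IH] y q S j hr.
  by right; exists q, S, j; rewrite /= mul0r addr0 addn0; split=> // v; left.
move=> /andP[ry /= hzs] /andP[yz hp] /andP[yn uz] hv hc.
have yB : y \notin B by case/and3P: ry.
have T0 := delay_ge0.
case: (active_or_delivered j.+1 yB) => [act|d]; last first.
  left; exists y, j; split=> //; first by rewrite inE eqxx.
  by rewrite lerDl mulr_ge0.
have nd : ~ delivered j.+1 y by case: act => rec E; rewrite /delivered E.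
have [j1 [jj1 hj1 Ej1 hocc]] := forward ry hr nd yz; have [_ _ qS cS] := hr.
have hr1 : reads z y (q |: S) j1.
  split=> //; first by apply: hv; rewrite inE eqxx.
  by rewrite cardsU1 qS add1n; apply: leq_trans hc; rewrite -addn1 leq_add2l.
have dle t : (t <= date x j1 + (size zs)%:R * T -> t <= date x j + (size zs).+1%:R * T)%R.
  by move=> h; apply: le_trans h _; rewrite -natr1 mulrDl mul1r; lra.
case: (IH z y (q |: S) j1 hr1 hzs hp uz).
- move=> v vz; rewrite inE negb_or inE; apply/andP; split.
    by apply: contraNneq yn => <-.
  by apply: hv; rewrite inE vz orbT.
- by rewrite cardsU1 qS add1n addSnnS.
- case=> y' [j' [hy' hj' d]]; left; exists y', j'; split=> //; last exact: dle.
  by rewrite inE hy' orbT.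
case=> p' [S' [j' [hj' jj' hr' hS']]]; right; exists p', S', j'; split=> //.
- exact: dle.
- by apply: leq_trans jj'; rewrite /= addnS -addSn leq_add2r.
move=> v /hS'[|vz]; last by right; rewrite inE vz orbT.
by rewrite !inE => /orP[-> |]; [right | left].
Qed.

(* Waves start from both ends.  Either the one from [r] reaches the first node
   after the message of [q], or the one from [q] reaches the last node after the
   message of [r]; overwriting [Rec] in the meantime cannot prevent this. *)
Lemma arc_progress q y zs r a a' t : sent q a -> sent r a' ->
  (date x a <= t)%R -> (date x a' <= t)%R ->
  all relay (y :: zs) -> path e q (rcons (y :: zs) r) -> uniq (q :: rcons (y :: zs) r) ->
  size zs <= Z - 3 ->
  exists2 y', y' \in y :: zs & delivered_by y' (t + (size zs).+1%:R * T)%R.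
Proof.
move=> sq sr ta ta' hrel hpath; rewrite cons_uniq mem_rcons in_cons negb_or => /andP[/andP[qr qn]].
rewrite rcons_uniq => /andP[rn hu] hc.
move: hpath; rewrite rcons_path => /andP[qhp lr].
have /andP[qy hp] : e q y && path e y zs := qhp.
have ry : relay y by case/andP: hrel.
set w := last y zs; have wy : w \in y :: zs by apply: mem_last.
have rw : relay w by apply: (allP hrel).
have [i1 [ai1 hi1 R1 F1]] := first_read sq qy ry.
have rw_e : e r w by rewrite e_sym.
have [j1 [aj1 hj1 R2 F2]] := first_read sr rw_e rw.
have Erev : w :: rev (belast y zs) = rev (y :: zs) by rewrite [in RHS]lastI rev_rcons.
have Elast : last w (rev (belast y zs)) = y.
  by rewrite -[RHS](last_rcons w (rev zs) y) -rev_cons -Erev.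
have sz : size (rev (belast y zs)) = size zs by rewrite size_rev size_belast.
have T0 := delay_ge0.
have fin y' j' : y' \in y :: zs ->
    (date x j' <= date x i1 + (size zs)%:R * T \/ date x j' <= date x j1 + (size zs)%:R * T)%R ->
    delivered j'.+1 y' ->
    exists2 y', y' \in y :: zs & delivered_by y' (t + (size zs).+1%:R * T)%R.
  by move=> hy hd d; exists y' => //; exists j' => //; rewrite -natr1 mulrDl mul1r; case: hd; lra.
case: (wave R1 hrel hp hu).
- by move=> v vy; rewrite setU0 inE; apply: contraNneq qn => <-.
- by rewrite cards0 add0n.
- by case=> y' [j' [h1 h2 h3]]; apply: (fin y' j') => //; left.
case=> p [S [ik [hik iik Rk HS]]].
case: (wave R2 (zs := rev (belast y zs))).
- by rewrite Erev all_rev.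
- rewrite /w rev_path (eq_path (e' := e)) // => u v; exact: e_sym.
- by rewrite Erev rev_uniq.
- move=> v; rewrite Erev mem_rev setU0 => vy; rewrite inE.
  by apply: contraNneq rn => <-.
- by rewrite cards0 add0n sz.
- rewrite Erev sz => -[y' [j' [h1 h2 h3]]]; apply: (fin y' j') => //; last by right.
  by rewrite -mem_rev.
rewrite Elast sz Erev => -[p' [S' [jk [hjk jjk Rk' HS']]]].
have out v u W W' : (forall v, v \in W |: W' -> v \in u |: set0 \/ v \in y :: zs) ->
    v != u -> v \notin y :: zs -> v != W /\ v \notin W'.
  move=> h vu vn; split; apply/negP => hv.
    have /h[] : v \in W |: W' by rewrite !inE hv.
      by rewrite setU0 inE (negPf vu).
    by rewrite (negPf vn).
  have /h[] : v \in W |: W' by rewrite !inE hv orbT.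
    by rewrite setU0 inE (negPf vu).
  by rewrite (negPf vn).
have [lt|le] := ltnP i1 jk.
  have HS2 v : v \in p' |: S' -> v \in r |: set0 \/ v \in y :: zs.
    by move=> /HS'[|]; [left|right; rewrite -mem_rev].
  have [qp qS] := out q r _ _ HS2 qr qn.
  by apply: (fin y jk); [rewrite inE eqxx|right|apply: collide lt Rk' qp qS].
have rq : r != q by rewrite eq_sym.
have [rp rS] := out r q _ _ HS rq rn.
have [lt|le'] := ltnP j1 ik.
  by apply: (fin w ik); [|left|apply: collide lt Rk rp rS].
(* Each wave arrives no later than the first read at the other end, so neither has advanced: the arc
   is one node reading both messages in the same activation, and with both records present it cannot
   be active. *)
have zs0 : size zs = 0.
  by have := leq_trans iik (leq_trans le' (leq_trans (leq_addr _ _) (leq_trans jjk le)));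
    rewrite -[leqRHS]addn0 leq_add2l leqn0 => /eqP.
have E1 : i1 = j1.
  apply/eqP; rewrite eqn_leq (leq_trans _ (leq_trans iik le')) ?leq_addr //.
  by rewrite (leq_trans _ (leq_trans jjk le)) ?leq_addr.
have Ew : w = y by rewrite /w; case: (zs) zs0.
have yB : y \notin B by case/and3P: ry.
case: (active_or_delivered i1.+1 yB) => [[rec E]|d]; last first.
  by apply: (fin y i1) => //; [rewrite inE eqxx | left; rewrite lerDl mulr_ge0].
have [_ /(_ _ E) r1] := F1 i1.+1 (leqnn _).
rewrite -E1 Ew in F2; have [_ /(_ _ E) r2] := F2 i1.+1 (leqnn _).
have := (execution_sound i1.+1).2 y yB; rewrite E => -[_ /(_ m0)]; case.
by exists r, q, set0; rewrite inE.
Qed.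

End Execution.

End Protocol.

(** * Spreading along a shortest path *)

Section Balls.
Variables (V : finType) (e : rel V).
Hypothesis e_sym : symmetric e.

Fixpoint ball (k : nat) (c : V) : {set V} :=
  if k is k'.+1 then \bigcup_(x in ball k' c) (x |: [set y | e x y]) else [set c].

Lemma ball_succ k c : ball k c \subset ball k.+1 c.
Proof. by apply/subsetP => x h; apply/bigcupP; exists x; rewrite // !inE eqxx. Qed.

Lemma ball_mono k l c : k <= l -> ball k c \subset ball l c.
Proof.
move/subnK <-; elim: (l - k) => [|n IH]; first by rewrite add0n.
exact: subset_trans IH (ball_succ _ _).
Qed.

Lemma ball_walk k l c x y : x \in ball k c -> walk e l x y -> y \in ball (k + l) c.
Proof.
move=> + /walkP[p [hp <- <-]]; elim: p k x hp => [|a p IH] k x /=; first by rewrite addn0.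
move=> /andP[xa hp] hx; rewrite addnS -addSn; apply: IH => //.
by apply/bigcupP; exists x; rewrite // !inE xa orbT.
Qed.

Lemma card_ball k c : #|ball k c| <= (max_degree e).+1 ^ k.
Proof.
elim: k => [|k IH]; first by rewrite cards1.
have h : #|ball k.+1 c| <= \sum_(x in ball k c) #|x |: [set y | e x y]|.
  rewrite /= -!big_enum /=; elim: (enum _) => [|x l IHl]; first by rewrite !big_nil cards0.
  by rewrite !big_cons (leq_trans (leq_card_setU _ _)) // leq_add2l.
apply: leq_trans h _; rewrite expnSr.
apply: (@leq_trans (\sum_(x in ball k c) (max_degree e).+1)); last first.
  by rewrite sum_nat_const leq_mul2r IH orbT.
apply: leq_sum => x _; rewrite cardsU1 -add1n leq_add ?leq_b1 //.
exact: (leq_bigmax (F := degree e)).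
Qed.

Lemma card_darts_at (A : {set V}) :
  #|[set d : V * V | dart e d && (d.1 \in A)]| <= #|A| * max_degree e.
Proof.
rewrite -sum1_card (partition_big (fun d => d.1) [in A]) /=; last first.
  by move=> d; rewrite inE => /andP[].
rewrite -sum_nat_const; apply: leq_sum => x _.
rewrite sum1dep_card; apply: leq_trans (leq_bigmax (F := degree e) x).
rewrite /degree -[leqLHS](card_in_imset (f := snd)).
  apply: subset_leq_card; apply/subsetP => y /imsetP[d]; rewrite !inE.
  by move=> /andP[/andP[dd _] /eqP <-] ->.
by move=> d d'; rewrite !inE => /andP[_ /eqP E] /andP[_ /eqP E']; apply: dart_ext; rewrite E.
Qed.

End Balls.

Section Spread.
Variables (V : finType) (e : rel V) (emb : plane_embedding e).
Hypotheses (e_sym : symmetric e) (e_irr : irreflexive e).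
Hypotheses (e_4conn : four_connected e) (e_deg : 4 <= max_degree e).
Variables (Z : nat) (B : {set V}) (s : V).
Hypotheses (Z3 : 3 <= Z) (Zmax : max_polygon_edges emb <= Z) (sB : s \notin B).
Hypothesis B_far :
  forall b1 b2, b1 \in B -> b2 \in B -> b1 != b2 -> Z < distance e b1 b2.
Variables (M : Type) (m0 : M) (R : realFieldType) (i0 : nat) (x : trace R V M) (T : R).
Hypotheses (x_exec : execution e s Z B m0 i0 x) (x_delay : activation_delay_le T x).

Local Notation nu := (nu emb).
Local Notation phi := (phi emb).
Local Notation dart := (dart e).
Local Notation fc := (fc emb).
Local Notation inc := (inc emb).
Local Notation good := (good emb B).
Local Notation star := (star emb).
Local Notation by_time := (delivered_by m0 x).
Local Notation simple := (@face_simple _ _ emb e_sym e_irr e_4conn e_deg).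

Let t1 : R := (date x i0 + T)%R.

Definition full (d : V * V) (t : R) : Prop := forall d', d' \in fc d -> by_time d'.1 t.

Lemma T_ge0 : (0 <= T)%R.
Proof. exact: delay_ge0 x_exec x_delay. Qed.

Lemma full_le d t t' : (t <= t')%R -> full d t -> full d t'.
Proof. by move=> h f d' hd; apply: delivered_by_le h (f d' hd). Qed.

Lemma good_correct d d' : good d -> d' \in fc d -> d'.1 \notin B.
Proof.
move=> gd hd; apply/negP => hB; have := good_inc (emb := emb) (d := d) hB; rewrite gd => h.
by have : ~~ true by apply: h; apply/incP; exists d' => //; apply/eqP; rewrite -mem_fc.
Qed.

Lemma good_size d : good d -> #|fc d| <= Z.
Proof.
by case/and3P => dd o _; apply: leq_trans (inner_face_size e_sym e_irr e_4conn e_deg dd o) Zmax.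
Qed.

Lemma iter_phi_inj d i j : dart d -> i < #|fc d| -> j < #|fc d| ->
  (iter i phi d).1 = (iter j phi d).1 -> i = j.
Proof.
move=> dd; rewrite cardsE => hi hj E.
have E2 : iter i phi d = iter j phi d.
  by apply: simple; rewrite ?dart_iter_phi // !fc_iter.
by rewrite -(findex_iter hi) E2 findex_iter.
Qed.

(** [A] collects nodes that have delivered if correct, and each round adds one, from an arc between
    consecutive members of [A] on the contour. The source and its neighbours must belong to [A]
    because they do not relay. *)
Lemma face_fill n d e1 e2 (A : {set V}) t : good d -> (t1 <= t)%R ->
  (forall v, v \in A -> v \notin B -> by_time v t) ->
  (forall v, v = s \/ e s v -> v \in A) ->
  e1 \in fc d -> e2 \in fc d -> e1.1 \in A -> e2.1 \in A -> e1.1 != e2.1 ->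
  #|[set d' in fc d | d'.1 \notin A]| <= n ->
  full d (t + n%:R * (Z%:R * T))%R.
Proof.
have T0 := T_ge0.
elim: n A t => [|n IH] A t gd ht hA hs h1 h2 a1 a2 n12 hn.
  move=> d' hd; rewrite mul0r addr0; apply: hA; last exact: good_correct hd.
  move: hn; rewrite leqn0 cards_eq0 => /eqP /setP /(_ d').
  by rewrite in_set hd in_set0 => /negbFE.
have [none|[d2 hd2 nd2]] : (forall d', d' \in fc d -> d'.1 \in A) \/
    exists2 d', d' \in fc d & d'.1 \notin A.
  case: (boolP [exists d', (d' \in fc d) && (d'.1 \notin A)]) => [/existsP[d' /andP[]]|].
    by right; exists d'.
  by move/existsPn => h; left => d' hd; have := h d'; rewrite hd /= negbK.
  move=> d' hd; apply: delivered_by_le (hA _ (none d' hd) (good_correct gd hd)).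
  by rewrite lerDl !mulr_ge0.
have dd : dart d by apply: good_dart gd.
have [d0 hd0 [a0 na0]] : exists2 d0, d0 \in fc d & d0.1 \in A /\ (phi d0).1 \notin A.
  move: (hd2); rewrite mem_fc -(eqP (etrans (esym (mem_fc _ _ _)) h1)) -mem_fc.
  rewrite inE => /iter_findex E; move: nd2; rewrite -E.
  elim: (findex _ _ _) => [|k IHk] /=; first by rewrite a1.
  case: (boolP ((iter k phi e1).1 \in A)) => h; last by move=> _; apply: IHk.
  by exists (iter k phi e1) => //; rewrite mem_fc fc_iter.
have F0 : fc d0 = fc d by apply/eqP; rewrite -mem_fc.
have dd0 : dart d0 by rewrite (dart_fc e_sym hd0).
have mem0 i : iter i phi d0 \in fc d by rewrite mem_fc fc_iter F0.
pose u i := (iter i phi d0).1.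
have ex : exists k, (0 < k) && (u k \in A).
  exists (order phi d0); rewrite order_gt0 /u iter_order //; exact: phi_inj.
case: (ex_minnP ex) => m /andP[m0' um] minm.
have m2 : 1 < m.
  move: m m0' um minm => [|[|m]] // _ um _.
  by move: na0; rewrite -[phi d0]/(iter 1 phi d0) -/(u 1) um.
(* Two distinct nodes of [A] on the face keep the ends of the arc distinct. *)
have mlt : m < #|fc d0|.
  have [d3 hd3 [a3 n3]] : exists2 d3, d3 \in fc d0 & d3.1 \in A /\ d3.1 != d0.1.
    rewrite F0; have [E|n01] := eqVneq e1.1 d0.1; last by exists e1.
    by exists e2; rewrite // -E eq_sym.
  have [i hi E] := fc_iterP hd3; apply: leq_ltn_trans hi; apply: minm.
  by rewrite /u -E a3 andbT; case: (i) E n3 => // ->; rewrite eqxx.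
have mZ : m < Z by apply: leq_trans mlt _; rewrite F0; apply: good_size.
have notA i : 0 < i < m -> u i \notin A.
  by move=> /andP[h0 hm]; apply/negP => h; have := minm i; rewrite h0 h leqNgt hm => /(_ isT).
have correct i : u i \notin B by apply: good_correct gd (mem0 i).
have edge i : e (u i) (u i.+1).
  rewrite /u /= phi1; have := dart_iter_phi emb e_sym i d0; rewrite dd0.
  by rewrite /dart.
have notS i : 0 < i < m -> u i != s /\ ~~ e s (u i).
  move=> /notA h; split; first by apply: contraNneq h => E; apply: hs; left.
  by apply: contraNN h => E; apply: hs; right.
(* An end of the arc is not the source, or the adjacent inner node would be in [A]; so it did
   multicast [(m0, set0)]. *)
have endp i j : u i \in A -> 0 < j < m -> e (u i) (u j) ->
    exists2 a, (date x a <= t)%R & sent e s B m0 x (u i) a.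
  move=> ui hj eij; have us : u i != s.
    by apply: contraTneq eij => ->; have [_] := notS j hj.
  have [k hk dk] := hA _ ui (correct i).
  have [a ak sa] := delivered_sent e_sym sB Z3 B_far x_exec (correct i) us dk.
  by exists a => //; apply: le_trans (date_mono x_exec ak) hk.
have [a ta sa] := endp 0 1 a0 m2 (edge 0).
have [k Em] : exists k, m = k.+2 by case: (m) m2 => [|[|k]] // _; exists k.
subst m.
have [a' ta' sa'] : exists2 a, (date x a <= t)%R & sent e s B m0 x (u k.+2) a.
  by apply: (endp k.+2 k.+1) => //; rewrite ?ltnSn // e_sym.
have Eu l j : path e (u j) [seq u i | i <- iota j.+1 l].
  by elim: l j => //= l IHl j; rewrite edge IHl.
pose zs := [seq u i | i <- iota 2 k].
have Eseq : rcons (u 1 :: zs) (u k.+2) = [seq u i | i <- iota 1 k.+2].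
  by rewrite -[k.+2]addn1 iotaD map_cat cats1 /= add1n addn1.
have inzs y : y \in u 1 :: zs -> exists2 i, 0 < i < k.+2 & y = u i.
  rewrite -[u 1 :: zs]/[seq u i | i <- iota 1 k.+1] => /mapP[i].
  by rewrite mem_iota add1n => hi ->; exists i.
have [] := @arc_progress V M e s Z B m0 e_sym e_irr sB Z3 B_far R i0 x T x_exec x_delay
  (u 0) (u 1) zs (u k.+2) a a' t sa sa' ta ta'.
- apply/allP => y /inzs[i hi ->]; rewrite /relay correct.
  by have [-> ->] := notS i hi.
- by rewrite Eseq; apply: Eu.
- rewrite Eseq -[_ :: _]/[seq u i | i <- iota 0 k.+3] map_inj_in_uniq ?iota_uniq //.
  move=> i j; rewrite !mem_iota !ltnS => /= hi hj; apply: iter_phi_inj => //.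
    exact: leq_ltn_trans hi mlt.
  exact: leq_ltn_trans hj mlt.
(* [k.+2 < Z] is exactly the budget [k <= Z - 3] of the protocol. *)
- by rewrite size_map size_iota leq_subRL // add3n.
move=> y /inzs[i hi Ey]; rewrite size_map size_iota => hy.
have lem : (k.+1%:R * T <= Z%:R * T)%R.
  by rewrite ler_wpM2r // ler_nat; apply: ltnW (ltnW mZ).
have := IH (y |: A) (t + Z%:R * T)%R gd.
have ht' : (t <= t + Z%:R * T)%R by rewrite lerDl mulr_ge0.
move=> /(_ (le_trans ht ht')) IH'.
suff : full d (t + Z%:R * T + n%:R * (Z%:R * T))%R.
  apply: full_le; rewrite -natr1 mulrDl mul1r; lra.
apply: IH'.
- move=> v; rewrite !inE => /orP[/eqP -> _|vA vB].
    by apply: delivered_by_le hy; lra.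
  exact: delivered_by_le ht' (hA v vA vB).
- by move=> v /hs h; rewrite inE h orbT.
- exact: h1.
- exact: h2.
- by rewrite inE a1 orbT.
- by rewrite inE a2 orbT.
- exact: n12.
rewrite -ltnS; apply: leq_trans hn; apply: proper_card; apply/properP; split.
  by apply/subsetP => z; rewrite !in_set negb_or => /and3P[-> _ ->].
exists (iter i phi d0); first by rewrite in_set mem0 -/(u i) notA.
by rewrite in_set in_setU1 -/(u i) Ey eqxx andbF.
Qed.

(** A polygon has at most [Z] nodes to gain, each within [Z * T]. *)
Let tau : R := (Z%:R * (Z%:R * T))%R.

Lemma tau_ge0 : (0 <= tau)%R.
Proof. by rewrite !mulr_ge0 // T_ge0. Qed.

Lemma face_full d v w t : good d -> (t1 <= t)%R -> inc v d -> inc w d -> v != w ->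
  by_time v t -> by_time w t -> full d (t + tau)%R.
Proof.
move=> gd ht /incP[dv Ev Fv] /incP[dw Ew Fw] nvw hv hw.
have T0 := T_ge0; pose A := [set y | [|| y == v, y == w, y == s | e s y]].
have hA y : y \in A -> y \notin B -> by_time y t.
  rewrite inE => /or4P[/eqP -> //|/eqP -> //|/eqP -> _|sy yB].
    by apply: delivered_by_le (source_delivered sB x_exec); move: ht; rewrite /t1; lra.
  by apply: delivered_by_le ht (source_neighbours e_sym e_irr sB Z3 B_far x_exec x_delay yB sy).
have := @face_fill #|[set d' in fc d | d'.1 \notin A]| d dv dw A t gd ht hA.
move=> h; apply: full_le (h _ _ _ _ _ _ (leqnn _)).
- rewrite lerD2l ler_wpM2r ?mulr_ge0 // ler_nat; apply: leq_trans (good_size gd).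
  by apply: subset_leq_card; apply/subsetP => z; rewrite inE => /andP[].
- by move=> y [->|sy]; rewrite inE ?eqxx ?sy ?orbT.
- by rewrite mem_fc Fv.
- by rewrite mem_fc Fw.
- by rewrite inE Ev eqxx.
- by rewrite inE Ew eqxx orbT.
by rewrite Ev Ew.
Qed.

Lemma full_eps d t : good (eps d) -> (t1 <= t)%R -> full d t -> full (eps d) (t + tau)%R.
Proof.
move=> g ht f; have dd : dart (eps d) by apply: good_dart g.
apply: (@face_full (eps d) d.1 d.2) => //; first exact: (inc2 emb (eps d)).
- exact: (inc1 emb (eps d)).
- by apply: contraTneq dd => E; rewrite /dart /= E e_irr.
- exact: f (fc_refl _ _).
by rewrite -(phi1 emb d); apply: f; rewrite mem_fc fc_phi.
Qed.

Lemma source_full d : good d -> d.1 = s -> full d (t1 + tau)%R.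
Proof.
move=> g Es; have dd : dart d by apply: good_dart g.
have T0 := T_ge0.
apply: (@face_full d d.1 d.2) => //; rewrite ?inc1 ?inc2 //.
- by apply: contraTneq dd => E; rewrite /dart /= E e_irr.
- by rewrite Es; apply: delivered_by_le (source_delivered sB x_exec); rewrite /t1; lra.
apply: (source_neighbours e_sym e_irr sB Z3 B_far x_exec x_delay); last by rewrite -Es.
by rewrite -(phi1 emb d); apply: good_correct g _; rewrite mem_fc fc_phi.
Qed.

(** * Faces linked within a region *)

Section Region.
Variables (N : {set V}) (d0 : V * V).
Hypotheses (good0 : good d0) (N0 : d0.1 \in N).

(** Crossing only edges that meet [N] keeps the linked faces near [N], so that their number is
    bounded, and still makes them closed at every node of [N]. *)
Definition link : rel (V * V) := fun d d' =>
  [&& good d, good d' & (d' == phi d) || (d' == eps d) && ((d.1 \in N) || (d.2 \in N))].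

Definition linked (d : V * V) : bool := connect link d0 d.

Lemma linked_good d : linked d -> good d.
Proof.
case/connectP => p; elim/last_ind: p d => [|p a _] d /=; first by move=> _ ->.
by rewrite rcons_path last_rcons => /andP[_ /and3P[_ g _]] ->.
Qed.

Lemma linked_phi d : linked (phi d) = linked d.
Proof.
have fwd y : linked y -> linked (phi y).
  move=> h; apply: (connect_trans h (connect1 _)).
  by rewrite /link good_phi // (linked_good h) eqxx.
apply/idP/idP; last exact: fwd.
have : fconnect phi (phi d) d by rewrite (fconnect_sym (@phi_inj _ _ emb)) fconnect1.
move=> /iter_findex E h; rewrite -E; elim: (findex _ _ _) => //= k; exact: fwd.
Qed.

Lemma linked_eps d : linked d -> good (eps d) -> (d.1 \in N) || (d.2 \in N) -> linked (eps d).
Proof.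
move=> h g hN; apply: (connect_trans h (connect1 _)).
by rewrite /link (linked_good h) g eqxx hN orbT.
Qed.

Lemma linked_closed v : v \in N -> closed_at emb B linked v.
Proof.
move=> vN d Ed gd gn; have ge : good (eps d) by rewrite -(good_phi emb e_sym) phi_eps.
rewrite -phi_eps linked_phi; apply/idP/idP => h; first by apply: linked_eps; rewrite // Ed vN.
by rewrite -[d]epsK; apply: linked_eps; rewrite ?epsK //= Ed vN orbT.
Qed.

Lemma link_near p : path link d0 p -> forall d, d \in d0 :: p ->
  good d /\ exists2 v, v \in N & inc v d.
Proof.
elim/last_ind: p => [|p a IH] /=.
  by move=> _ d; rewrite inE => /eqP ->; split=> //; exists d0.1; rewrite ?inc1.
rewrite rcons_path => /andP[hp /and3P[_ ga hl]] d; rewrite -rcons_cons mem_rcons inE.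
case/orP => [/eqP ->|]; last exact: IH.
split=> //; have [_ [v vN iv]] := IH hp _ (mem_last d0 p).
case/orP: hl => [/eqP ->|/andP[/eqP -> /orP[h|h]]].
- by exists v; rewrite // (inc_fc v (fc_phi emb _)).
- by exists (last d0 p).1; rewrite // -[X in inc X]/(eps (last d0 p)).2 inc2.
by exists (last d0 p).2; rewrite // -[X in inc X]/(eps (last d0 p)).1 inc1.
Qed.

Lemma full_path p t : path link d0 p -> (t1 <= t)%R -> full d0 t ->
  full (last d0 p) (t + (size p)%:R * tau)%R.
Proof.
have tau0 := tau_ge0.
elim/last_ind: p => [|p a IH] /=; first by rewrite mul0r addr0.
rewrite rcons_path last_rcons size_rcons => /andP[hp /and3P[_ ga hl]] ht f0.
have f := IH hp ht f0; case/orP: hl => [/eqP E|/andP[/eqP E _]].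
  rewrite E => d'; rewrite mem_fc fc_phi -mem_fc => /f; apply: delivered_by_le.
  by rewrite -natr1 mulrDl mul1r; lra.
rewrite E in ga *; rewrite -natr1 mulrDl mul1r addrA; apply: full_eps => //.
by apply: le_trans ht _; rewrite lerDl mulr_ge0.
Qed.

End Region.

Let L : nat := (max_degree e).+1 ^ (3 * Z).+1 * max_degree e.

Lemma face_near v d : good d -> inc v d -> exists2 k, k <= Z & walk e k v d.1.
Proof.
move=> g i; have [k hk w] := face_walk e_sym (good_dart g) i (inc1 emb d).
exists k => //; apply: leq_trans (leq_trans hk (good_size g)).
by rewrite -addnn leq_addr.
Qed.

(** A path without repetition visits distinct darts on faces touching the ball, all of which start
    within [Z] more hops; [L] bounds their number. *)
Lemma full_linked c d0 d t : good d0 -> d0.1 \in ball e (2 * Z).+1 c -> (t1 <= t)%R ->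
  full d0 t -> linked (ball e (2 * Z).+1 c) d0 d -> full d (t + L%:R * tau)%R.
Proof.
move=> g0 h0 ht f0 /connectP[p hp ->]; case: (shortenP hp) => q hq uq _.
apply: full_le (full_path hq ht f0); rewrite lerD2l ler_wpM2r ?tau_ge0 // ler_nat.
apply: leq_trans (leqnSn _) _; rewrite -[(size q).+1]/(size (d0 :: q)) -(card_uniqP uq).
apply: leq_trans (_ : #|[set d : V * V | dart d && (d.1 \in ball e (3 * Z).+1 c)]| <= _).
  apply: subset_leq_card; apply/subsetP => z /(link_near g0 h0 hq)[gz [v vN iv]].
  rewrite inE (good_dart gz) /=; have [k kZ w] := face_near gz iv.
  apply: (subsetP (ball_mono e c (_ : (2 * Z).+1 + k <= (3 * Z).+1))); last exact: ball_walk vN w.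
  by rewrite addSn ltnS [3 * Z]mulSn addnC leq_add2r.
by apply: leq_trans (card_darts_at e _) _; rewrite leq_mul2r card_ball orbT.
Qed.

Lemma star_walk b v : v \in star b -> exists2 k, k <= Z & walk e k v b.
Proof.
case/starP => _ [d [dd <- o i]]; have [k hk w] := face_walk e_sym dd (inc1 emb d) i.
exists k => //; apply: leq_trans (leq_trans hk _).
  by rewrite -addnn leq_addr.
exact: leq_trans (inner_face_size e_sym e_irr e_4conn e_deg dd o) Zmax.
Qed.

(** At a Byzantine node the claim concerns its neighbours, so the step out of it is immediate. *)
Definition informed (a : V) (t : R) : Prop :=
  if a \in B then forall n d, e a n -> good d -> d.1 = n -> full d t
  else forall d, good d -> d.1 = a -> full d t.

Lemma informed_step a a' t : e a a' -> (t1 <= t)%R -> informed a t ->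
  informed a' (t + L%:R * tau)%R.
Proof.
move=> aa' ht; rewrite /informed.
have tle : (t <= t + L%:R * tau)%R by rewrite lerDl mulr_ge0 ?tau_ge0.
have Z1 : 0 < Z by apply: leq_trans Z3.
case: ifP => aB.
  case: ifP => a'B h; last by move=> d g E; apply: full_le tle (h a' d aa' g E).
  have n : a != a' by apply: contraTneq aa' => ->; rewrite e_irr.
  have := B_far aB a'B n.
  by rewrite ltnNge (leq_trans (distance_leq (walk1 aa')) Z1).
move=> h; have [d0 g0 E0] := good_at e_sym e_irr e_4conn e_deg Zmax B_far (negbT aB).
(* Large enough for the stars of all Byzantine nodes whose star contains [a] or a neighbour of
   [a]. *)
set N := ball e (2 * Z).+1 a.
have inN v k : k <= (2 * Z).+1 -> walk e k a v -> v \in N.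
  move=> hk w; apply: (subsetP (ball_mono e a hk)).
  by rewrite -[k]add0n; apply: ball_walk w; rewrite /= inE.
have aN : a \in N by apply: (inN _ 0) => //; apply: walk0.
have N0 : d0.1 \in N by rewrite E0.
have f0 := h d0 g0 E0; pose X := linked N d0.
have Xg d : X d -> good d by apply: linked_good.
have Xp d : X (phi d) = X d by apply: linked_phi.
have Xc v : v \in N -> closed_at emb B X v by apply: linked_closed.
have fX d : X d -> full d (t + L%:R * tau)%R by apply: full_linked.
have starN b v k : k <= 1 -> walk e k a v -> v \in star b ->
    forall y, y \in star b -> closed_at emb B X y.
  move=> hk w /star_walk[l lZ w1] y /star_walk[m mZ w2]; apply: Xc.
  apply: (inN _ (k + (l + m))); last first.
    by apply: walk_cat w (walk_cat w1 _); apply: walk_sym.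
  by rewrite mul2n -addnn -add1n leq_add // leq_add.
have loc v k : k <= 1 -> walk e k a v -> locally_closed emb B X v.
  move=> hk w; split; first by apply: Xc; apply: inN w; apply: leq_trans hk _.
  by move=> b _ vb; apply: starN w vb.
have la := loc a 0 isT (walk0 e a); have la' := loc a' 1 isT (walk1 aa').
have ca := vertex_const e_sym e_irr e_4conn e_deg Zmax B_far Xg Xp (negbT aB) la.
have sa : status emb B X a by rewrite (statusE ca g0 E0) /X /linked connect0.
case: ifP => a'B; last first.
  move=> d g E; apply: fX.
  have ca' := vertex_const e_sym e_irr e_4conn e_deg Zmax B_far Xg Xp (negbT a'B) la'.
  rewrite -(statusE ca' g E).
  by rewrite -(edge_status e_sym e_irr e_4conn e_deg Zmax B_far Xg Xp
    (negbT aB) (negbT a'B) aa' la la').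
move=> n d bn g E; apply: fX.
(* At most one side of the edge is outer, so the other is a polygon containing both ends. *)
have b_star v : e a' v -> v \in star a'.
  move=> bv; have vb : e v a' by rewrite e_sym.
  apply/starP; split; first by apply: contraTneq bv => ->; rewrite e_irr.
  have [o|o] := eqVneq (fc (v, a')) (outer emb); last first.
    by exists (v, a'); split=> //; apply: (inc2 emb (v, a')).
  exists (nu (v, a')); split; rewrite ?dart_nu ?nu1 //.
    apply/eqP => o'; have /eqP : nu (v, a') = (v, a').
      by apply: simple; rewrite ?dart_nu ?nu1 ?o.
    by rewrite (negPf (nu_neq e_irr e_4conn e_deg emb (vb : dart (v, a')))).
  by rewrite (inc_fc _ (fc_nu emb _)); apply: (inc1 emb (a', v)).
have ba : e a' a by rewrite e_sym.
have clos := starN a' a 0 isT (walk0 e a) (b_star a ba).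
have cn := star_const e_sym e_irr e_4conn e_deg Zmax B_far Xg Xp a'B clos (b_star n bn).
rewrite -(statusE cn g E).
by rewrite -(byz_neighbours e_sym e_irr e_4conn e_deg Zmax B_far Xg Xp a'B clos ba bn).
Qed.

Lemma informed_walk k p : walk e k s p -> informed p (t1 + tau + k%:R * (L%:R * tau))%R.
Proof.
have tau0 := tau_ge0; have step0 j : (0 <= j%:R * (L%:R * tau) :> R)%R.
  by rewrite mulr_ge0 ?ler0n // mulr_ge0 ?ler0n.
elim: k p => [|k IH] p /walkP[q [hq Eq sq]].
  rewrite -Eq; case: q sq {hq Eq} => // _ /=; rewrite /informed (negPf sB) => d g E.
  by apply: full_le (source_full g E); rewrite mul0r addr0.
case/lastP: q sq hq Eq => // q a; rewrite size_rcons last_rcons rcons_path => -[sq] /andP[hq qa] Ea.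
rewrite -Ea -natr1 mulrDl mul1r addrA; apply: informed_step qa _ _.
  by have := step0 k; lra.
by apply: IH; apply/walkP; exists q.
Qed.

Lemma delivery_time p : p \notin B ->
  delivers_by x p m0
    (date x i0 + (T + tau + L%:R * tau) * (diameter e)%:R)%R.
Proof.
move=> pB; have T0 := T_ge0; have tau0 := tau_ge0.
have Lt0 : (0 <= L%:R * tau :> R)%R by rewrite mulr_ge0.
apply: (delivered_byE sB x_exec pB).
have [E|ps] := eqVneq p s.
  rewrite E; apply: delivered_by_le (source_delivered sB x_exec).
  by rewrite lerDl mulr_ge0 // !addr_ge0.
have cn : connect e s p.
  have := e_4conn (S := set0); rewrite cards0 => /(_ isT s p).
  rewrite !inE => /(_ isT isT); apply: connect_sub => u v /and3P[uv _ _].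
  exact: connect1.
have [k kd w] := walk_diameter cn.
have [d g Ed] := good_at e_sym e_irr e_4conn e_deg Zmax B_far pB.
have := informed_walk w; rewrite /informed (negPf pB) => /(_ d g Ed d (fc_refl _ _)).
rewrite Ed; apply: delivered_by_le; rewrite /t1.
(* As [p] differs from [s], the diameter is at least one and absorbs the additive [T + tau]. *)
have k0 : 0 < k.
  rewrite lt0n; apply: contraNneq ps => k0; move: w; rewrite k0.
  by case/walkP => -[|a q] [_ E sz] //; rewrite -E.
have d1 : (1 <= (diameter e)%:R :> R)%R by rewrite ler1n; apply: leq_trans kd.
have kdR : (k%:R <= (diameter e)%:R :> R)%R by rewrite ler_nat.
have h1 : (T + tau <= (T + tau) * (diameter e)%:R)%R by rewrite ler_peMr // addr_ge0.
have h2 : (k%:R * (L%:R * tau) <= (diameter e)%:R * (L%:R * tau))%R by rewrite ler_wpM2r.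
lra.
Qed.

End Spread.

Theorem theorem3 (R : realFieldType) (Y Z : nat) (T : R) :
  4 <= Y -> 3 <= Z ->
  exists C : R,
  forall (V : finType) (e : rel V) (emb : plane_embedding e),
    symmetric e -> irreflexive e -> four_connected e ->
    max_degree e = Y -> max_polygon_edges emb = Z ->
  forall (B : {set V}) (s : V),
    s \notin B ->
    (forall b1 b2, b1 \in B -> b2 \in B -> b1 != b2 -> Z < distance e b1 b2) ->
  forall (M : Type) (m0 : M) (i0 : nat) (x : trace R V M),
    execution e s Z B m0 i0 x ->
    activation_delay_le T x ->
  forall p : V, p \notin B ->
    delivers_by x p m0 (date x i0 + C * (diameter e)%:R)%R.
Proof.
move=> Y4 Z3; pose tau : R := (Z%:R * (Z%:R * T))%R.
exists (T + tau + (Y.+1 ^ (3 * Z).+1 * Y)%:R * tau)%R.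
move=> V e emb e_sym e_irr e_4conn EY EZ B s sB B_far M m0 i0 x x_exec x_delay p pB.
rewrite -EY in Y4 *; have Zmax : max_polygon_edges emb <= Z by rewrite EZ.
exact: (delivery_time e_sym e_irr e_4conn Y4 Z3 Zmax sB B_far x_exec x_delay pB).
Qed.
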